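(* Let $\mathcal H,\mathcal K$ be complex Hilbert spaces and $A\in\mathcal B(\mathcal H,\mathcal K)$. Let $\overline{\mathcal O}_G^G(A)$ be the norm closure in $\mathcal B(\mathcal H,\mathcal K)$ of $\{G_2AG_1^{-1}: G_1\in\mathcal G(\mathcal H),\ G_2\in\mathcal G(\mathcal K)\}$. Then $\overline{\mathcal O}_G^G(A)$ consists precisely of those operators $C\in\mathcal B(\mathcal H,\mathcal K)$ which satisfy the following three conditions: (a) $\iota_r(C)\le\iota_r(A)$; (b) if $\iota_b(A)=0$ and $\iota_b(C)=1$, then $\iota_r(C)<\iota_r(A)$; (c) there is a cardinal $\alpha$ for which $\iota_i(C)=\iota_i(A)+\alpha$ and $\iota_f(C)=\iota_f(A)+\alpha$. What is more, if $C\in\mathcal B(\mathcal H,\mathcal K)$ satisfies $\iota_i(C)=\dim\mathcal H$ and $\iota_f(C)=\dim\mathcal K$, then (c) is fulfilled for any $A\in\mathcal B(\mathcal H,\mathcal K)$.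
   Context: Hilbert spaces are complex and of arbitrary dimension; $\dim$ is the Hilbert space dimension (the cardinality of an orthonormal basis), and sums of dimensions are cardinal sums. $\mathcal B(\mathcal H,\mathcal K)$ is the space of bounded linear operators $\mathcal H\to\mathcal K$ with the operator norm. $\mathcal G(\mathcal H)$ is the group of all linear homeomorphisms of $\mathcal H$ onto itself. $\mathcal N(A)$, $\mathcal R(A)$, $\overline{\mathcal R}(A)$ denote the kernel, the range and the closure of the range of $A$. For a pre-Hilbert space $\mathcal E$ with completion $\overline{\mathcal E}$: the index of incompleteness is $\mathrm{IC}(\mathcal E)=\min\{\dim(\overline{\mathcal E}\ominus V): V \text{ a complete linear subspace of }\mathcal E\}$ ($\ominus$ denotes orthogonal complement); the binary index $\mathfrak b(\mathcal E)$ equals $1$ if $\mathcal E$ contains a (necessarily complete) subspace isomorphic to $\overline{\mathcal E}$ and equals $0$ otherwise. Indices of $A\in\mathcal B(\mathcal H,\mathcal K)$: $\iota_r(A)=\dim\overline{\mathcal R}(A)$; $\iota_i(A)=\dim\mathcal N(A)+\mathrm{IC}(\mathcal R(A))$; $\iota_f(A)=\dim(\mathcal K\ominus\overline{\mathcal R}(A))+\mathrm{IC}(\mathcal R(A))$; $\iota_b(A)=\mathfrak b(\mathcal R(A))\in\{0,1\}$. *)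

(* Defs.v *)
From HB Require Import structures.
From mathcomp Require Import all_boot all_order all_algebra.
From mathcomp Require Import sesquilinear.
From mathcomp.real_closed Require Import complex.
From mathcomp Require Import boolp classical_sets functions cardinality.
From mathcomp Require Import reals topology normedtype.

Set Implicit Arguments.
Unset Strict Implicit.
Unset Printing Implicit Defensive.

Import Order.TTheory GRing.Theory Num.Theory.
Import numFieldNormedType.Exports.

Local Open Scope classical_set_scope.
Local Open Scope card_scope.
Local Open Scope ring_scope.
Local Open Scope complex_scope.

(** Cardinals are represented by sets (over arbitrary carrier types): equality
    and order of cardinals are the relations [#=] and [#<=] of the library.
    Disjoint unions [#+] are sums of cardinals. The constructions below are
    meaningful up to [#=] only. *)

Definition card_lt (T U : Type) (A : set T) (B : set U) : Prop :=
  A #<= B /\ ~ (B #<= A).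

Notation "A '#<' B" := (card_lt A B) (at level 79) : card_scope.

Definition card_add (T U : Type) (A : set T) (B : set U) : set (T + U) :=
  (inl @` A) `|` (inr @` B).

Notation "A '#+' B" := (card_add A B) (at level 50, left associativity) : card_scope.

(** A member of [F] of least cardinality. Cardinals being well-ordered, it
    exists as soon as [F] is nonempty. *)
Definition card_min (T : Type) (F : set (set T)) : set T :=
  get [set D | F D /\ forall D', F D' -> D #<= D'].

(** The inner product is linear in its first argument, conjugate-linear in
    the second one. *)
HB.mixin Record CompleteNormedModule_isHilbert (R : realType) H
    of CompleteNormedModule R[i] H := {
  inner : {dot H for Num.conj} ;
  inner_norm : forall x : H, inner x x = `|x| ^+ 2
}.

#[short(type="hilbertType")]
HB.structure Definition Hilbert (R : realType) :=
  {H of CompleteNormedModule R[i] H & CompleteNormedModule_isHilbert R H}.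

Section Subspaces.
Context {R : realType} {H : hilbertType R}.
Implicit Types E V W B : set H.

Definition lin_subspace E : Prop := submod_closed [in E].

Definition complete_subset V : Prop :=
  forall F : set_system H, ProperFilter F -> cauchy F -> F V ->
    exists2 x, V x & F --> x.

(** [W ⊖ V] *)
Definition ominus W V : set H :=
  [set x | W x /\ forall v, V v -> inner x v = 0].

Definition orthonormal_set B : Prop :=
  forall x y, B x -> B y -> inner x y = (x == y)%:R.

(** An orthonormal basis of a closed subspace is a maximal orthonormal subset
    of it. *)
Definition orthonormal_basis V B : Prop :=
  [/\ B `<=` V, orthonormal_set B &
      forall B', B' `<=` V -> orthonormal_set B' -> B `<=` B' -> B' = B].

(** The Hilbert space dimension of a closed subspace: any two orthonormal
    bases are equipotent, and one of them is chosen to represent their common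
    cardinality. *)
Definition hdim V : set H := get (orthonormal_basis V).

(** Only the values of [U] on [V] matter. *)
Definition isomorphic V W : Prop :=
  exists U : H -> H,
    [/\ set_bij V W U,
        forall (a : R[i]) x y, V x -> V y -> U (a *: x + y) = a *: U x + U y &
        forall x y, V x -> V y -> inner (U x) (U y) = inner x y].

(** The pre-Hilbert spaces considered are linear subspaces [E] of a Hilbert
    space, so that the completion of [E] is its closure. *)

Definition IC E : set H :=
  card_min [set D | exists V, [/\ lin_subspace V, V `<=` E, complete_subset V &
                                  D = hdim (ominus (closure E) V)]].

Definition binary_index E : nat :=
  `[< exists W, [/\ lin_subspace W, W `<=` E & isomorphic (closure E) W] >].

End Subspaces.

Notation "''dim' H" := (hdim [set: H]) (at level 10, H at level 8).

Record bounded_op (R : realType) (H K : hilbertType R) := BoundedOp {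
  bop_fun :> {linear H -> K} ;
  bop_bounded : exists M : R, forall x, `|bop_fun x| <= M%:C * `|x|
}.

Notation "''B' ( H , K )" := (bounded_op H K) (format "''B' ( H ,  K )").

Record linear_homeo (R : realType) (H : hilbertType R) := LinearHomeo {
  lh_fun :> {linear H -> H} ;
  lh_inv : H -> H ;
  lh_funK : cancel lh_fun lh_inv ;
  lh_invK : cancel lh_inv lh_fun ;
  lh_continuous : continuous lh_fun ;
  lh_inv_continuous : continuous lh_inv
}.

Notation "''G' ( H )" := (linear_homeo H) (format "''G' ( H )").

Section Operators.
Context {R : realType} {H K : hilbertType R}.
Implicit Types A C T : 'B(H, K).

(** The norms are valued in [R[i]], the operator norm is taken in [R]. *)
Definition opnorm (f : H -> K) : R :=
  sup [set complex.Re `|f x| | x in [set x | `|x| <= 1]].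

Definition norm_closure (S : set 'B(H, K)) : set 'B(H, K) :=
  [set C | forall e : R, 0 < e -> exists2 T, S T & opnorm (C \- T) < e].

Definition GG_orbit A : set 'B(H, K) :=
  [set T | exists (G1 : 'G(H)) (G2 : 'G(K)),
             (T : H -> K) = G2 \o A \o lh_inv G1].

Definition nullspace A : set H := [set x | A x = 0].

Definition iota_r A : set K := hdim (closure (range A)).

Definition iota_i A : set (H + K) := hdim (nullspace A) #+ IC (range A).

Definition iota_f A : set (K + K) :=
  hdim (ominus [set: K] (closure (range A))) #+ IC (range A).

Definition iota_b A : nat := binary_index (range A).

End Operators.

(* Main.v *)
Require Import Defs.
From HB Require Import structures.
From mathcomp Require Import all_boot all_order all_algebra.
From mathcomp Require Import sesquilinear ring lra.
From mathcomp.real_closed Require Import complex.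
From mathcomp Require Import boolp classical_sets functions cardinality.
From mathcomp Require Import reals topology normedtype.

(** An invertible change of variables on both sides does not see the operator
    [A] itself, only how its closed range is filled by subspaces. Call [A]
    bounded below on a closed subspace [M] of [H] if [c |x| <= |A x|] on [M]
    for some [c > 0]; then [A @` M] is a complete subspace of the range, and by
    an open mapping argument ([closed_subrange]) every complete subspace of the
    range arises in this way. Such an [M] has three dimensions, those of [M],
    of its orthogonal complement, and of the orthogonal complement of
    [A @` M]. By [codim_source] and [codim_target] the last two are
    [dim N(A) + g] and [dim (K - cl R(A)) + g], where [g] is the codimension
    of [A @` M] in the closure of the range. Hence [iota_i A] and [iota_f A]
    are the codimensions of an optimal [M], that is, one for which [g] is
    minimal ([iota_optimal]), any other [M] has
    codimensions [iota_i A + a] and [iota_f A + a] for some [a]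
    ([iota_excess]), and [iota_b A] tells whether some [M] has dimension
    [iota_r A] ([iota_b1P]).

    If [C] is a limit of operators of the orbit and is bounded below on [M],
    then an operator of the orbit close to [C] is bounded below on [M] too,
    with an image whose complement has the same dimension. Pulling back by
    the homeomorphisms gives a subspace for [A] with the same three dimensions
    ([closure_transfer]). Taking [M] optimal for [C] yields (c), taking [M] of
    full dimension yields (b), and (a) is a semicontinuity property of the
    dimension ([hdim_range_approx]).

    Conversely, [spectral_split] provides for every [e > 0] a closed [M] such
    that [C] is bounded below on [M] and [|C x| <= e |x|] on the orthogonal
    complement of [M]. Under (a), (b) and (c), cardinal arithmetic
    ([card_exchange], [matching_subspace]) yields a subspace [M1] for [A] with
    the same three dimensions as [M]. Gluing unitary operators, one
    obtains [G1] and [G2] such that [G2 A G1^-1] equals [C] on [M] and is small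
    on the orthogonal complement ([orbit_near]).

    The last assertion is the decomposition of [H] and [K] along an optimal
    [M]: with [a = dim M], one has [dim H = iota_i A + a] and
    [dim K = iota_f A + a].

    Two tools carry the analysis. Dimensions are compared by means of
    nondegenerate bounded pairings ([hdim_eq_pairing]), which covers finite
    and infinite dimensions alike. The spectral splitting is obtained without
    functional calculus, from the growth of the iterates of
    [adj A \o A]. *)

Set Implicit Arguments.
Unset Strict Implicit.
Unset Printing Implicit Defensive.

Import Order.TTheory GRing.Theory Num.Theory.
Import numFieldNormedType.Exports.

Local Open Scope classical_set_scope.
Local Open Scope card_scope.

(** * Cardinal arithmetic *)

Lemma card_le_relP (T U : Type) (A : set T) (B : set U) :
  A #<= B <-> exists r : T -> U -> Prop,
    (forall x, A x -> exists2 y, B y & r x y) /\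
    (forall x x' y, A x -> A x' -> r x y -> r x' y -> x = x').
Proof.
split=> [/card_leP[f]|[r [rAB rinj]]].
  exists (fun x y => exists Ax : A x, y = val (f (SigSub (mem_set Ax)))); split.
    move=> x Ax; exists (val (f (SigSub (mem_set Ax)))); last by exists Ax.
    by apply: set_mem; exact: valP.
  move=> x x' y _ _ [Ax ->] [Ax' /val_inj/inj].
  by move=> /(_ (mem_set I) (mem_set I)) /(congr1 val).
apply/card_leP/injfunPex.
have /choice[g gP] : forall x : A, exists y : B, r (val x) (val y).
  by move=> [x Ax]; have [y By rxy] := rAB _ (set_mem Ax); exists (SigSub (mem_set By)).
exists g => // x x' _ _ e; apply: val_inj.
apply: (rinj _ _ (val (g x))); [exact: set_mem (valP x)|exact: set_mem (valP x')|exact: gP|].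
by rewrite e; exact: gP.
Qed.

Lemma card_le_fun (T U : Type) (A : set T) (B : set U) (f : T -> U) :
  (forall x, A x -> B (f x)) ->
  (forall x x', A x -> A x' -> f x = f x' -> x = x') -> A #<= B.
Proof.
move=> fAB finj; apply/card_le_relP; exists (fun x y => y = f x); split.
  by move=> x Ax; exists (f x) => //; exact: fAB.
by move=> x x' y Ax Ax' -> /finj; exact.
Qed.

Lemma card_le_sym (T U : Type) (A : set T) (B : set U) :
  A #<= B -> B #<= A -> A #= B.
Proof. by move=> AB BA; rewrite card_eq_le AB BA. Qed.

Lemma card_eqW (T U : Type) (A : set T) (B : set U) : A #= B -> A #<= B.
Proof. by rewrite card_eq_le => /andP[]. Qed.

Lemma card_eqWr (T U : Type) (A : set T) (B : set U) : A #= B -> B #<= A.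
Proof. by rewrite card_eq_le => /andP[]. Qed.

(** The class of cardinals is well-ordered: consider sets of choice functions
    of the family that are determined by any one of their values. If such a
    set is maximal, its values exhaust some member [D], and
    [s D |-> s D'] injects [D] into every other member [D']. *)
Lemma card_least (T : Type) (F : set (set T)) :
  F !=set0 -> exists2 D, F D & forall D', F D' -> D #<= D'.
Proof.
move=> [X0 FX0].
pose P (S : set (set T -> T)) :=
  (forall s X, S s -> F X -> X (s X)) /\
  (forall s s' X, S s -> S s' -> F X -> s X = s' X -> s = s').
have [|S [[SF Sinj] Smax]] := @Zorn_bigcup (set T -> T) P.
  move=> G GP tot; split=> [s X [S GS Ss]|s s' X [S GS Ss] [S' GS' Ss']] FX.
    by have [h _] := GP _ GS; exact: (h _ _ Ss FX).
  have [sub|sub] := tot _ _ GS GS'.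
    by have [_] := GP _ GS'; apply => //; exact: sub.
  by have [_] := GP _ GS; apply => //; exact: sub.
have [[D FD Dall]|nD] :=
    pselect (exists2 D, F D & forall x, D x -> exists2 s, S s & s D = x).
  exists D => // D' FD'; apply/card_le_relP.
  exists (fun x y => exists2 s, S s & s D = x /\ s D' = y); split=> [x Dx|].
    have [s Ss <-] := Dall _ Dx.
    by exists (s D'); [exact: (SF _ _ Ss FD')|exists s].
  move=> x x' y _ _ [s Ss [<- <-]] [s' Ss' [<-]] e.
  by rewrite (Sinj _ _ _ Ss' Ss FD' e).
have nD' X : F X -> exists2 x, X x & forall s, S s -> s X <> x.
  move=> FX; apply: contrapT => h; apply: nD; exists X => // x Xx.
  apply: contrapT => h'; apply: h; exists x => // s Ss e.
  by apply: h'; exists s.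
have [x0 _ _] := nD' _ FX0.
have /choice[s0 s0P] : forall X, exists x,
    F X -> X x /\ forall s, S s -> s X <> x.
  move=> X; have [FX|] := pselect (F X); last by exists x0.
  by have [x Xx h] := nD' _ FX; exists x.
exfalso; apply: (Smax (S `|` [set s0])).
  split; first by move=> s; left.
  move=> /(_ s0 (or_intror erefl)) Ss0.
  by have [_ /(_ s0 Ss0)] := s0P _ FX0.
split=> [s X [Ss|->] FX|]; [exact: (SF _ _ Ss FX)|by have [] := s0P _ FX|].
move=> s s' X [Ss|->] [Ss'|->] FX //.
- exact: Sinj.
- by move=> e; have [_ /(_ _ Ss)] := s0P _ FX.
- by move=> e; have [_ /(_ _ Ss')] := s0P _ FX; rewrite e.
Qed.

Lemma card_le_total (T U : Type) (A : set T) (B : set U) :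
  A #<= B \/ B #<= A.
Proof.
have hA : A #= (inl @` A : set (T + U)).
  by rewrite card_eq_sym; apply: inj_card_eq => x y _ _ [].
have hB : B #= (inr @` B : set (T + U)).
  by rewrite card_eq_sym; apply: inj_card_eq => x y _ _ [].
have [|D FD Dmin] := @card_least _ [set D | D = inl @` A \/ D = inr @` B].
  by exists (inl @` A); left.
rewrite (card_le_eql hA) (card_le_eqr hB) (card_le_eql hB) (card_le_eqr hA).
by case: FD => <-; [left|right]; apply: Dmin; [right|left].
Qed.

Lemma card_minP (T : Type) (F : set (set T)) :
  F !=set0 -> F (card_min F) /\ forall D, F D -> card_min F #<= D.
Proof.
move=> /card_least[D FD Dmin]; rewrite /card_min.
by apply: (@getPex _ [set D | F D /\ forall D', F D' -> D #<= D']); exists D.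
Qed.

Lemma finite_le_infinite (T U : Type) (A : set T) (B : set U) :
  finite_set A -> infinite_set B -> A #<= B.
Proof.
move=> fA iB; have [//|BA] := card_le_total A B.
by exfalso; apply: iB; exact: card_le_finite BA fA.
Qed.

(** A maximal disjoint family of countably infinite subsets exhausts [Y] up to
    a finite set, and each of them has the cardinality of its product with
    [nat]. *)
Lemma card_infinite_mul_nat (T : Type) (Y : set T) :
  infinite_set Y -> Y `*` [set: nat] #<= Y.
Proof.
move=> Yinf.
pose P (F : set (nat -> T)) :=
  (forall f n, F f -> Y (f n)) /\
  (forall f g n m, F f -> F g -> f n = g m -> f = g /\ n = m).
have [|F [[FY Finj] Fmax]] := @Zorn_bigcup (nat -> T) P.
  move=> G GP tot; split=> [f n [F GF Ff]|f g n m [F GF Ff] [F' GF' Fg]].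
    by have [h _] := GP _ GF; exact: h.
  have [sub|sub] := tot _ _ GF GF'.
    by have [_] := GP _ GF'; apply => //; exact: sub.
  by have [_] := GP _ GF; apply => //; exact: sub.
pose L := Y `\` [set x | exists f n, F f /\ f n = x].
have Lfin : finite_set L.
  apply: contrapT => /infiniteP /card_le_relP[r [rL rinj]].
  have /choice[h hP] : forall n, exists y, L y /\ r n y.
    by move=> n; have [y] := rL n I; exists y.
  apply: (Fmax (F `|` [set h])).
    split; first by move=> f; left.
    move=> /(_ h (or_intror erefl)) Fh.
    by have [[_ +] _] := hP 0%N; apply; exists h, 0%N.
  split=> [f n [Ff|->]|]; [exact: FY|by have [[]] := hP n|].
  move=> f g n m [Ff|->] [Fg|->] e.
  - exact: Finj.
  - by exfalso; have [[_ +] _] := hP m; apply; exists f, n.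
  - by exfalso; have [[_ +] _] := hP n; apply; exists g, m.
  - split=> //; apply: (rinj _ _ (h n)) => //; first by have [] := hP n.
    by rewrite e; have [] := hP m.
have [f0 Ff0] : F !=set0.
  apply: contrapT => F0; apply: Yinf; apply: sub_finite_set Lfin => x Yx.
  by split=> // -[f [n [Ff _]]]; apply: F0; exists f.
have /card_le_relP[l [lP linj]] : L #<= [set: nat] by exact: finite_set_countable.
pose c (n m : nat) := pickle (n, m).
have cinj n m n' m' : c n m = c n' m' -> n = n' /\ m = m'.
  by move=> /(pcan_inj pickleK)[].
apply/card_le_relP.
exists (fun x y =>
  (exists f n, [/\ F f, f n = x.1 & y = f (c n x.2).*2]) \/
  (exists n, [/\ L x.1, l x.1 n & y = f0 (c n x.2).*2.+1])); split.
  move=> [x m] [/= Yx _].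
  have [[f [n [Ff fn]]]|nF] := pselect (exists f n, F f /\ f n = x).
    by exists (f (c n m).*2); [exact: FY|left; exists f, n].
  have Lx : L x by [].
  have [n _ lxn] := lP _ Lx.
  by exists (f0 (c n m).*2.+1); [exact: FY|right; exists n].
have dS (a b : nat) : a.*2 = b.*2.+1 -> False.
  by move=> /(congr1 odd); rewrite oddS !odd_double.
move=> [x m] [x' m'] y _ _ /= [[f [n [Ff <- ->]]]|[n [Lx lxn ->]]]
    [[f' [n' [Ff' <-]]]|[n' [Lx' lxn']]].
- by move=> /(Finj _ _ _ _ Ff Ff')[-> /double_inj/cinj[-> ->]].
- by move=> /(Finj _ _ _ _ Ff Ff0)[_ /dS].
- by move=> /(Finj _ _ _ _ Ff0 Ff')[_ /esym/dS].
- move=> /(Finj _ _ _ _ Ff0 Ff0)[_ [/double_inj/cinj[e ->]]].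
  by rewrite (linj _ _ _ Lx Lx' lxn) // e.
Qed.

Lemma card_add_le2 (T T' U U' : Type) (A : set T) (A' : set T')
    (B : set U) (B' : set U') :
  A #<= A' -> B #<= B' -> A #+ B #<= A' #+ B'.
Proof.
move=> /card_le_relP[r [rA rinj]] /card_le_relP[s [sB sinj]].
apply/card_le_relP; exists (fun x y => match x, y with
  | inl a, inl a' => r a a' | inr b, inr b' => s b b' | _, _ => False end).
split=> [_ [[a Aa <-]|[b Bb <-]]|].
- by have [a' Aa' raa'] := rA _ Aa; exists (inl a') => //; left; exists a'.
- by have [b' Bb' sbb'] := sB _ Bb; exists (inr b') => //; right; exists b'.
move=> _ _ y [[a Aa <-]|[b Bb <-]] [[a' Aa' <-]|[b' Bb' <-]]; case: y => // z.
- by move=> h h'; rewrite (rinj _ _ _ Aa Aa' h h').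
- by move=> h h'; rewrite (sinj _ _ _ Bb Bb' h h').
Qed.

Lemma card_add_eq2 (T T' U U' : Type) (A : set T) (A' : set T')
    (B : set U) (B' : set U') :
  A #= A' -> B #= B' -> A #+ B #= A' #+ B'.
Proof.
rewrite !card_eq_le => /andP[? ?] /andP[? ?].
by rewrite !card_add_le2.
Qed.

Lemma card_add_eql (T T' U : Type) (A : set T) (A' : set T') (B : set U) :
  A #= A' -> A #+ B #= A' #+ B.
Proof. by move=> h; apply: card_add_eq2 => //; exact: card_eqxx. Qed.

Lemma card_add_eqr (T U U' : Type) (A : set T) (B : set U) (B' : set U') :
  B #= B' -> A #+ B #= A #+ B'.
Proof. by move=> h; apply: card_add_eq2 => //; exact: card_eqxx. Qed.

Lemma card_addC (T U : Type) (A : set T) (B : set U) : A #+ B #= B #+ A.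
Proof.
suff h (T' U' : Type) (A' : set T') (B' : set U') : A' #+ B' #<= B' #+ A'.
  by apply: card_le_sym.
apply: (@card_le_fun _ _ _ _
  (fun z => match z with inl a => inr a | inr b => inl b end)).
  by move=> _ [[a Aa <-]|[b Bb <-]]; [right; exists a|left; exists b].
by move=> [a|b] [a'|b'] _ _ // [->].
Qed.

Lemma card_addA (T U V : Type) (A : set T) (B : set U) (C : set V) :
  A #+ (B #+ C) #= A #+ B #+ C.
Proof.
apply: card_le_sym.
- apply: (@card_le_fun _ _ _ _ (fun z => match z with
    inl a => inl (inl a) | inr (inl b) => inl (inr b) | inr (inr c) => inr c end)).
    move=> _ [[a Aa <-]|[_ [[b Bb <-]|[c Cc <-]] <-]].
    + by left; exists (inl a) => //; left; exists a.
    + by left; exists (inr b) => //; right; exists b.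
    + by right; exists c.
  by move=> [a|[b|c]] [a'|[b'|c']] _ _ // [->].
- apply: (@card_le_fun _ _ _ _ (fun z => match z with
    inl (inl a) => inl a | inl (inr b) => inr (inl b) | inr c => inr (inr c) end)).
    move=> _ [[_ [[a Aa <-]|[b Bb <-]] <-]|[c Cc <-]].
    + by left; exists a.
    + by right; exists (inl b) => //; left; exists b.
    + by right; exists (inr c) => //; right; exists c.
  by move=> [[a|b]|c] [[a'|b']|c'] _ _ // [->].
Qed.

Lemma card_le_addr (T U : Type) (A : set T) (B : set U) : A #<= A #+ B.
Proof.
apply: (@card_le_fun _ _ _ _ inl); first by move=> x Ax; left; exists x.
by move=> x x' _ _ [].
Qed.

Lemma card_le_addl (T U : Type) (A : set T) (B : set U) : B #<= A #+ B.
Proof. by apply: card_le_trans (card_eqW (card_addC _ _)); exact: card_le_addr. Qed.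

Lemma card_add0 (T U : Type) (A : set T) (B : set U) : B = set0 -> A #+ B #= A.
Proof.
move=> ->; apply: card_le_sym; last exact: card_le_addr.
apply/card_le_relP; exists (fun x y => x = inl y); split.
  by move=> _ [[a Aa <-]|[b []]]; exists a.
by move=> x x' y _ _ -> ->.
Qed.

Lemma card_setU_disjoint (T : Type) (A B : set T) :
  (forall x, A x -> B x -> False) -> A `|` B #= A #+ B.
Proof.
move=> dAB; apply: card_le_sym.
  apply/card_le_relP; exists (fun x y => (A x /\ y = inl x) \/ (B x /\ y = inr x)).
  split=> [x [Ax|Bx]|].
  - by exists (inl x); [left; exists x|left].
  - by exists (inr x); [right; exists x|right].
  - by move=> x x' y _ _ [[_ ->]|[_ ->]] [[_ []]|[_ []]].
apply: (@card_le_fun _ _ _ _ (fun z => match z with inl a => a | inr b => b end)).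
  by move=> _ [[a Aa <-]|[b Bb <-]]; [left|right].
move=> _ _ [[a Aa <-]|[b Bb <-]] [[a' Aa' <-]|[b' Bb' <-]] e; subst => //.
- by case: (dAB _ Aa Bb').
- by case: (dAB _ Aa' Bb).
Qed.

Lemma card_le_split (T U : Type) (A : set T) (B : set U) :
  A #<= B -> exists X : set U, X `<=` B /\ X #= A.
Proof.
move=> /card_le_relP[r [rAB rinj]].
have [[x0 Ax0]|A0] := pselect (A !=set0).
  have [y0 _ _] := rAB _ Ax0.
  have /choice[f fP] : forall x, exists y, A x -> B y /\ r x y.
    move=> x; have [Ax|] := pselect (A x); last by exists y0.
    by have [y By rxy] := rAB _ Ax; exists y.
  exists (f @` A); split; first by move=> _ [x Ax <-]; have [] := fP _ Ax.
  apply: inj_card_eq => x x' /set_mem Ax /set_mem Ax' e.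
  have [_ h] := fP _ Ax; have [_ h'] := fP _ Ax'.
  by apply: (rinj _ _ _ Ax Ax' h); rewrite e.
exists set0; split=> //.
have -> : A = set0 by rewrite -subset0 => x Ax; apply: A0; exists x.
exact: card_eq00.
Qed.

Lemma card_setD_add (T : Type) (X B : set T) :
  X `<=` B -> B #= X #+ (B `\` X).
Proof.
move=> XB; rewrite -[X in X #= _](setDUK XB).
by apply: card_setU_disjoint => x Xx [].
Qed.

Lemma card_le_diff (T U : Type) (A : set T) (B : set U) :
  A #<= B -> exists C : set U, B #= A #+ C.
Proof.
move=> /card_le_split[X [XB XA]]; exists (B `\` X).
apply: card_eq_trans (card_setD_add XB) _.
exact: card_add_eql.
Qed.

Lemma card_add_absorb (T U : Type) (A : set T) (Y : set U) :
  infinite_set Y -> A #<= Y -> A #+ Y #= Y.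
Proof.
move=> Yinf AY; apply: card_le_sym; last exact: card_le_addl.
apply: card_le_trans (card_infinite_mul_nat Yinf).
have /card_le_trans : A #+ Y #<= Y #+ Y by apply: card_add_le2 => //; exact: card_lexx.
apply; apply: (@card_le_fun _ _ _ _
  (fun z => match z with inl a => (a, 0%N) | inr b => (b, 1%N) end)).
  by move=> _ [[a Aa <-]|[b Bb <-]].
by move=> [a|b] [a'|b'] _ _ [] // ->.
Qed.

Lemma card_add_absorbr (T U : Type) (A : set T) (Y : set U) :
  infinite_set Y -> A #<= Y -> Y #+ A #= Y.
Proof.
by move=> Yi AY; apply: card_eq_trans (card_addC _ _) _; exact: card_add_absorb.
Qed.

Lemma finite_card_add (T U : Type) (A : set T) (B : set U) :
  finite_set A -> finite_set B -> finite_set (A #+ B).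
Proof.
by move=> fA fB; rewrite /card_add finite_setU; split; exact: finite_image.
Qed.

Lemma card_add_II (a b : nat) : `I_a #+ `I_b #= `I_(a + b).
Proof.
have -> : `I_(a + b) = `I_a `|` [set k | (a <= k < a + b)%N].
  apply/seteqP; split=> k /=.
    by move=> kab; case: (ltnP k a) => ka; [left|right; rewrite ?kab].
  by case=> [ka|/andP[]//]; rewrite (leq_trans ka) // leq_addr.
rewrite card_eq_sym.
apply: card_eq_trans (card_setU_disjoint _) _ => [k /= ka /andP[]|].
  by rewrite leqNgt ka.
apply: card_add_eq2; first exact: card_eqxx.
apply: card_le_sym.
  apply: (@card_le_fun _ _ _ _ (fun k => k - a)%N) => /=.
    by move=> k /andP[ak kab]; rewrite ltn_subLR.
  move=> k k' /andP[ak _] /andP[ak' _] e.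
  by rewrite -(subnKC ak) e subnKC.
apply: (@card_le_fun _ _ _ _ (fun k => a + k)%N) => /=.
  by move=> k kb; rewrite leq_addr ltn_add2l.
by move=> k k' _ _ /addnI.
Qed.

Lemma card_add_cancel_le (T U V W : Type) (A : set T) (A' : set W)
    (B : set U) (C : set V) :
  finite_set A -> A' #= A -> A #+ B #<= A' #+ C -> B #<= C.
Proof.
move=> fA A'A h.
have {}h : A #+ B #<= A #+ C.
  by apply: card_le_trans h _; apply/card_eqW/card_add_eql.
have [fC|iC] := pselect (finite_set C); last first.
  apply: card_le_trans (card_le_addl A B) (card_le_trans h _).
  by apply/card_eqW/card_add_absorb => //; exact: finite_le_infinite.
have fB : finite_set B.
  apply: card_le_finite (card_le_trans (card_le_addl A B) h) _.
  exact: finite_card_add.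
case: fA fB fC => a Aa [b Bb] [c Cc].
rewrite (card_le_eql Bb) (card_le_eqr Cc) card_le_II.
rewrite -(leq_add2l a) -card_le_II.
rewrite -(card_le_eql (card_add_II a b)) -(card_le_eqr (card_add_II a c)).
by rewrite -(card_le_eql (card_add_eq2 Aa Bb)) -(card_le_eqr (card_add_eq2 Aa Cc)).
Qed.

Lemma card_add_cancel (T U V W : Type) (A : set T) (A' : set W)
    (B : set U) (C : set V) :
  finite_set A -> A' #= A -> A #+ B #= A' #+ C -> B #= C.
Proof.
move=> fA A'A h; apply: card_le_sym.
  by apply: (card_add_cancel_le fA A'A); exact: card_eqW.
apply: (@card_add_cancel_le _ _ _ _ A' A) => //; last exact: card_eqWr.
  by move: fA => [n ?]; exists n; apply: card_eq_trans A'A _.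
by rewrite card_eq_sym.
Qed.

(** The larger one of [A] and [B] absorbs the other one, unless both are
    finite. *)
Lemma card_add_lt (T U V : Type) (A : set T) (B : set U) (Y : set V) :
  infinite_set Y -> Y #<= A #+ B -> Y #<= A \/ Y #<= B.
Proof.
have gen (T' U' : Type) (A' : set T') (B' : set U') :
    infinite_set Y -> A' #<= B' -> Y #<= A' #+ B' -> Y #<= B'.
  move=> Yinf AB h.
  have Binf : infinite_set B'.
    move=> fB; apply: Yinf; apply: card_le_finite h _.
    by apply: finite_card_add => //; exact: card_le_finite AB fB.
  by apply: card_le_trans h _; apply/card_eqW/card_add_absorb.
move=> Yinf h; have [AB|BA] := card_le_total A B; [right; exact: gen AB h|left].
apply: (gen _ _ B A) => //; apply: card_le_trans h (card_eqW (card_addC _ _)).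
Qed.

(** If [v] is finite, then so is [k], and it cancels. If [v] is infinite and
    exceeds [k], then [m = v] will do, since [v] is absorbed by [i + a] and by
    [f + a]. If [k] equals the infinite [v], then [m] may be any cardinal up to
    [v]: take [m = a] when this is possible, and [m = 0] otherwise, in which
    case [a] is absorbed by [i] and by [f]. *)
Lemma card_exchange (Ti Tf Tv Tk Ta : Type) (i : set Ti) (f : set Tf)
    (v : set Tv) (k : set Tk) (a : set Ta) :
  k #<= v -> i #+ v #= k #+ (i #+ a) -> f #+ v #= k #+ (f #+ a) ->
  exists (T : Type) (m : set T),
    [/\ v #= k #+ m, i #+ m #= i #+ a & f #+ m #= f #+ a].
Proof.
move=> kv hi hf; have [fv|iv] := pselect (finite_set v).
  have [m hm] := card_le_diff kv; exists Tv, m; split=> //.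
    apply: (@card_add_cancel _ _ _ _ k k) => //; [exact: card_le_finite fv|].
    apply: card_eq_trans hi; rewrite card_eq_sym.
    apply: card_eq_trans (card_add_eqr _ hm) _.
    apply: card_eq_trans (card_addA _ _ _) _.
    apply: card_eq_trans (card_add_eql _ (card_addC _ _)) _.
    by rewrite card_eq_sym; exact: card_addA.
  apply: (@card_add_cancel _ _ _ _ k k) => //; [exact: card_le_finite fv|].
  apply: card_eq_trans hf; rewrite card_eq_sym.
  apply: card_eq_trans (card_add_eqr _ hm) _.
  apply: card_eq_trans (card_addA _ _ _) _.
  apply: card_eq_trans (card_add_eql _ (card_addC _ _)) _.
  by rewrite card_eq_sym; exact: card_addA.
have [vk|nvk] := pselect (v #<= k); last first.
  exists Tv, v.
  have gen (T : Type) (j : set T) : j #+ v #= k #+ (j #+ a) -> j #+ v #= j #+ a.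
    move=> hj.
    have vja : v #<= j #+ a.
      have [//|//] := card_add_lt iv (card_le_trans (card_le_addl j v) (card_eqW hj)).
    have ija : infinite_set (j #+ a) by move=> /(card_le_finite vja).
    have ijv : infinite_set (j #+ v) by move=> /(card_le_finite (card_le_addl j v)).
    apply: card_le_sym.
      apply: card_le_trans (card_eqW hj) _.
      by apply/card_eqW/card_add_absorb => //; exact: card_le_trans kv vja.
    by apply: card_le_trans (card_le_addl k _) (card_eqWr hj).
  split; [|exact: gen|exact: gen].
  by rewrite card_eq_sym; exact: card_add_absorb.
have kev : k #= v by exact: card_le_sym.
have ik : infinite_set k by move=> /(card_le_finite vk).
have [av|nav] := pselect (a #<= v).
  exists Ta, a; split; [|exact: card_eqxx|exact: card_eqxx].
  rewrite card_eq_sym; apply: card_eq_trans kev.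
  by apply: card_add_absorbr => //; exact: card_le_trans vk.
have va : v #<= a by have [] := card_le_total a v.
have ia : infinite_set a by move=> /(card_le_finite va).
exists void, set0.
have gen (T : Type) (j : set T) :
    j #+ v #= k #+ (j #+ a) -> j #+ (set0 : set void) #= j #+ a.
  move=> hj; apply: card_eq_trans (card_add0 _ erefl) _.
  rewrite card_eq_sym.
  have ajv : a #<= j #+ v.
    apply: card_le_trans (card_le_addl j a) _.
    by apply: card_le_trans (card_le_addl k _) (card_eqWr hj).
  have [aj|//] := card_add_lt ia ajv.
  by apply: card_add_absorbr => // /(card_le_finite aj).
split; [|exact: gen|exact: gen].
rewrite card_eq_sym; apply: card_eq_trans (card_add0 _ erefl) kev.
Qed.

Local Open Scope ring_scope.

Lemma card_ge_II (T : Type) (X : set T) n : ~ (X #<= `I_n) -> `I_n.+1 #<= X.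
Proof.
move=> nX; have [[m Xm]|iX] := pselect (finite_set X); last exact: finite_le_infinite.
rewrite (card_le_eqr Xm) card_le_II ltnNge; apply/negP => mn; apply: nX.
by rewrite (card_le_eql Xm) card_le_II.
Qed.

(** An infinite matrix with finitely independent rows and countable columns
    has at most as many rows as columns: if there are infinitely many columns,
    send a row to one of its nonzero entries; otherwise count dimensions. *)
Lemma card_le_matrix (F : fieldType) (T U : Type) (X : set T) (Y : set U)
    (a : T -> U -> F) :
  (forall y, Y y -> countable [set x | X x /\ a x y <> 0]) ->
  (forall n (e : 'I_n -> T) (c : 'I_n -> F), injective e ->
     (forall i, X (e i)) ->
     (forall y, Y y -> \sum_(i < n) c i * a (e i) y = 0) -> forall i, c i = 0) ->
  X #<= Y.
Proof.
move=> cntY indX.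
have nz x : X x -> exists2 y, Y y & a x y <> 0.
  move=> Xx; apply: contrapT => h.
  suff : (1 : F) = 0 by move/eqP; rewrite oner_eq0.
  apply: (indX 1%N (fun=> x) (fun=> 1) _ _ _ ord0) => //.
    by move=> i j _; rewrite (ord1 i) (ord1 j).
  move=> y Yy; rewrite big_ord1 mul1r; apply: contrapT => axy.
  by apply: h; exists y.
have [[n Yn]|Yinf] := pselect (finite_set Y); last first.
  apply: card_le_trans (card_infinite_mul_nat Yinf).
  have /choice[l lP] : forall y, exists r : T -> nat -> Prop, Y y ->
      (forall x, X x /\ a x y <> 0 -> exists n, r x n) /\
      (forall x x' n, X x /\ a x y <> 0 -> X x' /\ a x' y <> 0 ->
         r x n -> r x' n -> x = x').
    move=> y; have [Yy|] := pselect (Y y); last by exists (fun _ _ => True).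
    have /card_le_relP[r [r1 r2]] := cntY _ Yy; exists r => _; split=> // x hx.
    by have [m _ rm] := r1 _ hx; exists m.
  apply/card_le_relP; exists (fun x z => [/\ Y z.1, a x z.1 <> 0 & l z.1 x z.2]).
  split=> [x Xx|x x' [y m] Xx Xx' [/= Yy axy lm] [_ axy' lm']].
    have [y Yy axy] := nz _ Xx; have [/(_ x (conj Xx axy))[m lm] _] := lP _ Yy.
    by exists (y, m).
  have [_ linj] := lP _ Yy.
  exact: (linj x x' m (conj Xx axy) (conj Xx' axy') lm lm').
have [[y0 Yy0]|Y0] := pselect (Y !=set0); last first.
  apply/card_le_relP; exists (fun _ _ => False); split=> // x Xx.
  by have [y Yy _] := nz _ Xx; exfalso; apply: Y0; exists y.
apply: contrapT => nXY.
have : ~ (X #<= `I_n) by rewrite -(card_le_eqr Yn).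
move=> /card_ge_II/card_le_relP[r [r1 r2]].
have /choice[g gP] : forall i : 'I_n.+1, exists x, X x /\ r i x.
  by move=> i; have [x] := r1 i (ltn_ord i); exists x.
have ginj : injective g.
  move=> i j e; apply: val_inj => /=.
  have [_ ri] := gP i; have [_ rj] := gP j.
  by apply: (r2 i j (g i)); rewrite ?e //=; rewrite -?e //; exact: ltn_ord.
have /card_le_relP[s [s1 s2]] := card_eqW Yn.
have /choice[h hP] : forall j : 'I_n, exists y,
    (exists2 z, Y z & s z j) -> Y y /\ s y j.
  move=> j; have [[y Yy sy]|] := pselect (exists2 z, Y z & s z j).
    by exists y.
  by exists y0.
have hY y : Y y -> exists j, h j = y.
  move=> Yy; have [k /= kn syk] := s1 _ Yy; exists (Ordinal kn).
  have [|Yh sh] := hP (Ordinal kn); first by exists y.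
  exact: (s2 _ _ _ Yh Yy sh syk).
pose M := \matrix_(i < n.+1, j < n) a (g i) (h j).
have : kermx M != 0.
  rewrite -mxrank_eq0 mxrank_ker subn_eq0 -ltnNge.
  exact: leq_ltn_trans (rank_leq_col M) (ltnSn n).
case/rowV0Pn => v /sub_kermxP vM /negP; apply; apply/eqP/rowP => i.
rewrite mxE; apply: (indX _ g (v 0)) => // [j|y /hY[j <-]].
  by have [] := gP j.
transitivity ((v *m M) 0 j); last by rewrite vM mxE.
by rewrite mxE; apply: eq_bigr => k _; rewrite !mxE.
Qed.

Local Open Scope complex_scope.

(** * Inner product and norm *)

Section InnerProduct.
Context {R : realType} {H : hilbertType R}.
Implicit Types (x y z : H) (a : R[i]).

(** The norms take values in [R[i]], which is only partially ordered; the
    estimates below are made in [R]. *)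
Definition cabs a : R := complex.Re `|a|.
Definition nrm x : R := complex.Re `|x|.
Definition reip x y : R := complex.Re (inner x y).

Lemma cabsE a : `|a| = (cabs a)%:C.
Proof.
have := normr_ge0 a; rewrite /cabs.
by case: `|a| => u v; rewrite lecE /= => /andP[/eqP -> _].
Qed.

Lemma cabs_ge0 a : 0 <= cabs a.
Proof. by rewrite -lecR -cabsE; exact: normr_ge0. Qed.

Lemma nrmE x : `|x| = (nrm x)%:C.
Proof.
have := normr_ge0 x; rewrite /nrm.
by case: `|x| => u v; rewrite lecE /= => /andP[/eqP -> _].
Qed.

Lemma nrm_ge0 x : 0 <= nrm x.
Proof. by rewrite -lecR -nrmE; exact: normr_ge0. Qed.

Lemma nrm0 : nrm (0 : H) = 0.
Proof. by rewrite /nrm normr0. Qed.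

Lemma nrm_eq0 x : nrm x = 0 -> x = 0.
Proof. by move=> h; apply: normr0_eq0; rewrite nrmE h. Qed.

Lemma nrm_gt0 x : x <> 0 -> 0 < nrm x.
Proof. by move=> x0; rewrite lt_def nrm_ge0 andbT; apply/eqP => /nrm_eq0. Qed.

Lemma nrmN x : nrm (- x) = nrm x.
Proof. by rewrite /nrm normrN. Qed.

Lemma nrmBC x y : nrm (x - y) = nrm (y - x).
Proof. by rewrite -nrmN opprB. Qed.

Lemma nrmD x y : nrm (x + y) <= nrm x + nrm y.
Proof. by rewrite -lecR rmorphD /= -!nrmE ler_normD. Qed.

Lemma nrmB x y : nrm (x - y) <= nrm x + nrm y.
Proof. by rewrite -(nrmN y) nrmD. Qed.

Lemma nrm_triangle y x z : nrm (x - z) <= nrm (x - y) + nrm (y - z).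
Proof. by rewrite -[x - z](subrKA y) nrmD. Qed.

Lemma nrmZ a x : nrm (a *: x) = cabs a * nrm x.
Proof. by rewrite {1}/nrm normrZ cabsE nrmE -rmorphM. Qed.

Lemma cabsR (r : R) : 0 <= r -> cabs r%:C = r.
Proof. by move=> r0; rewrite /cabs ger0_norm ?lecR. Qed.

Lemma nrmZr (r : R) x : 0 <= r -> nrm (r%:C *: x) = r * nrm x.
Proof. by move=> r0; rewrite nrmZ cabsR. Qed.

Lemma ipC x y : inner y x = (inner x y)^*%C.
Proof. by rewrite (@hermC _ false Num.conj _ inner) expr0 mul1r. Qed.

Lemma ipDl x y z : inner (x + y) z = inner x z + inner y z.
Proof. exact: linearDl. Qed.
Lemma ipDr x y z : inner z (x + y) = inner z x + inner z y.
Proof. exact: linearD. Qed.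
Lemma ipNl x y : inner (- x) y = - inner x y.
Proof. exact: linearNl. Qed.
Lemma ipNr x y : inner x (- y) = - inner x y.
Proof. exact: linearN. Qed.
Lemma ipBl x y z : inner (x - y) z = inner x z - inner y z.
Proof. exact: linearBl. Qed.
Lemma ipBr x y z : inner z (x - y) = inner z x - inner z y.
Proof. exact: linearB. Qed.
Lemma ip0l x : inner 0 x = 0.
Proof. exact: linear0l. Qed.
Lemma ip0r x : inner x 0 = 0.
Proof. exact: linear0. Qed.
Lemma ipZl a x y : inner (a *: x) y = a * inner x y.
Proof. exact: linearZl_LR. Qed.
Lemma ipZr a x y : inner x (a *: y) = a^* * inner x y.
Proof. exact: linearZr_LR. Qed.

Lemma ip_eq0C x y : inner x y = 0 -> inner y x = 0.
Proof. by move=> h; rewrite ipC h rmorph0. Qed.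

Lemma nrm_sqC x : inner x x = (nrm x ^+ 2)%:C.
Proof. by rewrite inner_norm nrmE rmorphXn. Qed.

Lemma reipC x y : reip y x = reip x y.
Proof. by rewrite /reip ipC; case: (inner x y). Qed.
Lemma reipDl x y z : reip (x + y) z = reip x z + reip y z.
Proof. by rewrite /reip ipDl raddfD. Qed.
Lemma reipDr x y z : reip z (x + y) = reip z x + reip z y.
Proof. by rewrite /reip ipDr raddfD. Qed.
Lemma reipNl x y : reip (- x) y = - reip x y.
Proof. by rewrite /reip ipNl raddfN. Qed.
Lemma reipNr x y : reip x (- y) = - reip x y.
Proof. by rewrite /reip ipNr raddfN. Qed.
Lemma reipZl (r : R) x y : reip (r%:C *: x) y = r * reip x y.
Proof. by rewrite /reip ipZl; case: (inner x y) => u v /=; rewrite mul0r subr0. Qed.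
Lemma reipZr (r : R) x y : reip x (r%:C *: y) = r * reip x y.
Proof. by rewrite reipC reipZl reipC. Qed.

Definition reipE := (reipDl, reipDr, reipNl, reipNr, reipZl, reipZr).

Lemma nrm_sq x : nrm x ^+ 2 = reip x x.
Proof. by rewrite /reip nrm_sqC. Qed.

Lemma ip_eq0 x : inner x x = 0 -> x = 0.
Proof.
move=> h; apply: nrm_eq0; apply/eqP; rewrite -sqrf_eq0 nrm_sq /reip h.
exact: eqxx.
Qed.

Lemma reip_ge0 x : 0 <= reip x x.
Proof. by rewrite -nrm_sq sqr_ge0. Qed.

Lemma reip_le x y : reip x y <= nrm x * nrm y.
Proof.
have [->|/nrm_gt0 nx] := pselect (x = 0); first by rewrite /reip ip0l nrm0 mul0r.
have := reip_ge0 ((nrm y)%:C *: x - (nrm x)%:C *: y).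
rewrite !reipE (reipC x y) -!nrm_sq.
have [->|/nrm_gt0 ny] := pselect (y = 0); first by rewrite /reip ip0r nrm0 mulr0.
move=> h; rewrite -(ler_pM2l (mulr_gt0 nx ny)); lra.
Qed.

Lemma cabsM a b : cabs (a * b) = cabs a * cabs b.
Proof. by rewrite /cabs normrM !cabsE -rmorphM. Qed.

Lemma Re_le_cabs a : complex.Re a <= cabs a.
Proof.
by rewrite /cabs normc_def /=; case: a => u v /=;
   rewrite (le_trans (ler_norm u)) // -sqrtr_sqr ler_wsqrtr // lerDl sqr_ge0.
Qed.

Lemma conjM_cabs a : a^* * a = (cabs a ^+ 2)%:C.
Proof. by rewrite mulrC -normCK cabsE rmorphXn. Qed.

Lemma cabs_conj a : cabs a^* = cabs a.
Proof. by rewrite /cabs norm_conjC. Qed.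

Lemma cabs_eq0 a : cabs a = 0 -> a = 0.
Proof. by move=> h; apply/eqP; rewrite -normr_eq0 cabsE h. Qed.

Lemma cabs_le_eq0 a : (forall e : R, 0 < e -> cabs a <= e) -> a = 0.
Proof.
move=> h; apply: cabs_eq0; apply: le_anti; rewrite cabs_ge0 andbT.
by apply/ler_addgt0Pr => e e0; rewrite add0r; exact: h.
Qed.

Lemma cabs_ip_le x y : cabs (inner x y) <= nrm x * nrm y.
Proof.
have := reip_le ((inner x y)^* *: x) y.
rewrite /reip ipZl conjM_cabs nrmZ cabs_conj /= expr2 -mulrA.
have [->|c0] := eqVneq (cabs (inner x y)) 0.
  by rewrite mulr_ge0 ?nrm_ge0.
by rewrite ler_pM2l // lt_def c0 cabs_ge0.
Qed.

Lemma nrm_eq_ip x y : (forall z, inner x z = inner y z) -> x = y.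
Proof. by move=> h; apply/subr0_eq/ip_eq0; rewrite ipBl h subrr. Qed.

Lemma nrm_pyth x y : inner x y = 0 -> nrm (x + y) ^+ 2 = nrm x ^+ 2 + nrm y ^+ 2.
Proof.
by move=> h; rewrite !nrm_sq !reipE (reipC x y) {2 3}/reip h /= !addr0 add0r.
Qed.

Lemma nrm_suml (n : nat) (c : 'I_n -> R[i]) (f : 'I_n -> H) y :
  inner (\sum_i c i *: f i) y = \sum_i c i * inner (f i) y.
Proof.
elim/big_rec2: _ => [|i u v _ <-]; first exact: ip0l.
by rewrite ipDl ipZl.
Qed.


Lemma gt0_complexP (e : R[i]) : 0 < e -> 0 < complex.Re e /\ e = (complex.Re e)%:C.
Proof. by case: e => a b; rewrite ltcE /= => /andP[/eqP -> ->]. Qed.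

Lemma cauchy_nrm (u : nat -> H) :
  (forall e : R, 0 < e -> exists N, forall m n, (N <= m)%N -> (N <= n)%N ->
     nrm (u m - u n) < e) ->
  exists x, forall e : R, 0 < e -> exists N, forall n, (N <= n)%N ->
     nrm (x - u n) < e.
Proof.
move=> cu.
have cx : cauchy_ex (u @ \oo).
  move=> e /gt0_complexP[e0 eE]; have [N NP] := cu _ e0.
  exists (u N); exists N => // n /= Nn; rewrite -ball_normE /ball_ /= nrmE eE ltcR.
  exact: NP.
have /cauchy_cvg/cvg_ex[x xl] : cauchy (u @ \oo) by exact: cauchy_exP.
exists x => e e0; have /cvgrPdist_lt := xl.
move=> /(_ e%:C); rewrite ltcR => /(_ e0) [N _ NP].
by exists N => n Nn; have := NP _ Nn; rewrite /= nrmE ltcR.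
Qed.

Lemma approx_seq (E : set H) x :
  (forall e : R, 0 < e -> exists2 y, E y & nrm (x - y) < e) ->
  exists2 u : nat -> H, forall n, E (u n) &
    forall e : R, 0 < e -> exists N, forall n, (N <= n)%N -> nrm (x - u n) < e.
Proof.
move=> h.
have /choice[u uP] : forall n : nat, exists y, E y /\ nrm (x - y) < n.+1%:R^-1.
  move=> n; have inv0 : 0 < n.+1%:R^-1 :> R by rewrite invr_gt0 ltr0n.
  by have [y Ey xy] := h _ inv0; exists y.
exists u => [n|e e0]; first by have [] := uP n.
exists (Num.truncn e^-1) => n Nn; have [_ un] := uP n.
apply: lt_le_trans un _; rewrite -[leRHS]invrK lef_pV2 ?posrE ?invr_gt0 ?ltr0n //.
by apply/ltW/(lt_le_trans (truncnS_gt _)); rewrite ler_nat ltnS.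
Qed.

Lemma closureP (E : set H) x :
  closure E x <-> forall e : R, 0 < e -> exists2 y, E y & nrm (x - y) < e.
Proof.
split=> [cE e e0|h B].
  have [|y [Ey]] := cE (ball x e%:C); first by apply: nbhsx_ballx; rewrite ltcR.
  by rewrite -ball_normE /ball_ /= nrmE ltcR; exists y.
move=> /nbhs_ballP[e /= /gt0_complexP[e0 eE] eB].
have [y Ey xy] := h _ e0; exists y; split=> //; apply: eB.
by rewrite -ball_normE /ball_ /= nrmE eE ltcR.
Qed.

End InnerProduct.

Lemma nrm_ip_eq (R : realType) (H K : hilbertType R) (x : H) (y : K) :
  inner x x = inner y y -> nrm x = nrm y.
Proof.
move=> h; apply/eqP; rewrite -(@eqrXn2 _ 2) ?nrm_ge0 //.
by rewrite !nrm_sq /reip h.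
Qed.

(** * Closed subspaces, projections and adjoints *)

Definition metric_closed {R : realType} {H : hilbertType R} (D : set H) : Prop :=
  forall x, (forall e : R, 0 < e -> exists2 y, D y & nrm (x - y) < e) -> D x.

Definition clsub {R : realType} {H : hilbertType R} (V : set H) : Prop :=
  [/\ V 0, forall a x y, V x -> V y -> V (a *: x + y) & metric_closed V].

Definition blin {R : realType} {H K : hilbertType R} (f : H -> K) : Prop :=
  (forall a x y, f (a *: x + y) = a *: f x + f y) /\
  exists2 M : R, 0 <= M & forall x, nrm (f x) <= M * nrm x.

Definition orthc {R : realType} {H : hilbertType R} (V : set H) : set H :=
  ominus [set: H] V.

Definition proj {R : realType} {H : hilbertType R} (V : set H) (x : H) : H :=
  get [set p | V p /\ forall v, V v -> inner (x - p) v = 0].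

Definition adj {R : realType} {H K : hilbertType R} (f : H -> K) (y : K) : H :=
  get [set z | forall x, inner (f x) y = inner x z].

Section Subspace.
Context {R : realType} {H : hilbertType R}.
Implicit Types (V W : set H) (x y z : H).

Lemma clsubZ V a x : clsub V -> V x -> V (a *: x).
Proof. by move=> [V0 VD _] Vx; rewrite -[_ *: _]addr0; exact: VD. Qed.

Lemma clsubD V x y : clsub V -> V x -> V y -> V (x + y).
Proof. by move=> [V0 VD _] Vx Vy; rewrite -[x]scale1r; exact: VD. Qed.

Lemma clsubN V x : clsub V -> V x -> V (- x).
Proof. by move=> cV Vx; rewrite -scaleN1r; exact: clsubZ. Qed.

Lemma clsubB V x y : clsub V -> V x -> V y -> V (x - y).
Proof. by move=> cV Vx Vy; apply: clsubD => //; exact: clsubN. Qed.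

Lemma clsubT : clsub [set: H]. Proof. by []. Qed.

Lemma clsubI V W : clsub V -> clsub W -> clsub (V `&` W).
Proof.
move=> [V0 VD Vc] [W0 WD Wc]; split=> [//|a x y [Vx Wx] [Vy Wy]|x h].
  by split; [exact: VD|exact: WD].
by split; [apply: Vc|apply: Wc] => e /h [y [Vy Wy] xy]; exists y.
Qed.

Lemma half_double x : (2^-1 : R)%:C *: (x + x) = x.
Proof.
rewrite scalerDr -scalerDl -rmorphD /=.
by have -> : 2^-1 + 2^-1 = 1 :> R; [field|rewrite scale1r].
Qed.

(** In a decreasing sequence of convex sets, almost norm-minimal points form a
    Cauchy sequence, by the parallelogram law. *)
Lemma nested_convex (D : nat -> set H) (c : R) :
  (forall n, D n !=set0) -> (forall n, D n.+1 `<=` D n) ->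
  (forall n x, D n x -> nrm x <= c) ->
  (forall n x y, D n x -> D n y -> D n ((2^-1 : R)%:C *: (x + y))) ->
  (forall n, metric_closed (D n)) ->
  exists x, forall n, D n x.
Proof.
move=> D0 Ddec Dc Dmid Dcl.
have Dle m n : (m <= n)%N -> D n `<=` D m.
  elim: n => [|n ih]; first by rewrite leqn0 => /eqP ->.
  by rewrite leq_eqVlt => /predU1P[->//|/ih h x /Ddec/h].
pose E n : set R := [set nrm y ^+ 2 | y in D n].
have Elb n : has_lbound (E n) by exists 0 => _ [y _ <-]; exact: sqr_ge0.
have Einf n : has_inf (E n).
  by split=> //; have [y Dy] := D0 n; exists (nrm y ^+ 2); exists y.
pose d n := inf (E n).
have dlb n y : D n y -> d n <= nrm y ^+ 2.
  by move=> Dy; apply: ge_inf => //; exists y.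
have dc n : d n <= c ^+ 2.
  have [y Dy] := D0 n; apply: le_trans (dlb _ _ Dy) _.
  by rewrite lerXn2r ?nnegrE ?nrm_ge0 ?(Dc _ _ Dy) // (le_trans (nrm_ge0 y)) ?(Dc _ _ Dy).
have dsup : has_sup (range d).
  by split; [exists (d 0%N); exists 0%N|exists (c ^+ 2) => _ [n _ <-]].
pose s := sup (range d).
have ds n : d n <= s by apply: ub_le_sup; [case: dsup|exists n].
have inv0 (n : nat) : 0 < n.+1%:R^-1 :> R by rewrite invr_gt0 ltr0n.
have /choice[p pP] : forall n, exists y, D n y /\ nrm y ^+ 2 < d n + n.+1%:R^-1.
  move=> n; have [_ [y Dy <-] yd] := inf_adherent (inv0 n) (Einf n).
  by exists y.
have mid n x y : D n x -> D n y ->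
    nrm (x - y) ^+ 2 <= 2 * nrm x ^+ 2 + 2 * nrm y ^+ 2 - 4 * d n.
  move=> Dx Dy; have := dlb _ _ (Dmid _ _ _ Dx Dy).
  by rewrite !nrm_sq !reipE (reipC x y); lra.
have [|x xP] := @cauchy_nrm R H p.
  move=> e e0; pose eta := e ^+ 2 / 9.
  have eta0 : 0 < eta by rewrite divr_gt0 // exprn_gt0.
  have [_ [k _ <-] dk] := sup_adherent eta0 dsup.
  have [N NP] : exists N : nat, N.+1%:R^-1 < eta.
    exists (Num.truncn eta^-1); rewrite -ltf_pV2 ?posrE ?inv0 // invrK.
    exact: truncnS_gt.
  exists (maxn k N) => m n; rewrite !geq_max => /andP[km Nm] /andP[kn Nn].
  have pD j : (k <= j)%N -> D k (p j) by move=> kj; have [/(Dle _ _ kj)] := pP j.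
  have pj j : (N <= j)%N -> nrm (p j) ^+ 2 < s + eta.
    move=> Nj; have [_ h] := pP j; apply: lt_le_trans h _; apply: lerD => //.
    apply: le_trans (ltW NP); rewrite lef_pV2 ?posrE ?ltr0n // ler_nat.
    by rewrite ltnS.
  have := mid _ _ _ (pD _ km) (pD _ kn).
  have := pj _ Nm; have := pj _ Nn; rewrite -/s in dk.
  move=> h1 h2 h3; rewrite -(@ltr_pXn2r _ 2) ?nnegrE ?nrm_ge0 ?(ltW e0) //.
  have eE : e ^+ 2 = 9 * eta by rewrite /eta; field.
  by rewrite eE; lra.
exists x => n; apply: Dcl => e e0; have [N NP] := xP _ e0.
exists (p (maxn n N)); last by apply: NP; exact: leq_maxr.
by apply: (Dle n (maxn n N)); [exact: leq_maxl|have [] := pP (maxn n N)].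
Qed.

Lemma projP V x : clsub V ->
  V (proj V x) /\ forall v, V v -> inner (x - proj V x) v = 0.
Proof.
move=> cV; have [V0 VD Vcl] := cV.
apply: (@getPex _ [set p | V p /\ forall v, V v -> inner (x - p) v = 0]).
pose E : set R := [set nrm (x - v) | v in V].
have Elb : has_lbound E by exists 0 => _ [v _ <-]; exact: nrm_ge0.
have Einf : has_inf E by split=> //; exists (nrm (x - 0)); exists 0.
pose d := inf E.
have dlb v : V v -> d <= nrm (x - v) by move=> Vv; apply: ge_inf => //; exists v.
have inv0 (n : nat) : 0 < n.+1%:R^-1 :> R by rewrite invr_gt0 ltr0n.
have inv1 (n : nat) : n.+1%:R^-1 <= 1 :> R.
  by rewrite invf_le1 ?ltr0n // ler1n.
pose D n : set H := [set y | V (x - y) /\ nrm y <= d + n.+1%:R^-1].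
have [|||||y yD] := @nested_convex D (d + 1).
- move=> n; have [_ [v Vv <-] vd] := inf_adherent (inv0 n) Einf.
  by exists (x - v); split; [rewrite subKr|exact: ltW].
- move=> n y [Vy yd]; split=> //; apply: le_trans yd _; apply: lerD => //.
  by rewrite lef_pV2 ?posrE ?ltr0n // ler_nat.
- by move=> n y [_ yd]; apply: le_trans yd _; rewrite lerD2l.
- move=> n y z [Vy yd] [Vz zd]; split.
    have -> : x - (2^-1)%:C *: (y + z) = (2^-1)%:C *: ((x - y) + (x - z)).
      by rewrite addrACA -opprD scalerBr half_double.
    by apply: clsubZ => //; exact: clsubD.
  rewrite nrmZr; last by rewrite invr_ge0.
  by move: (_ + _^-1) (nrmD y z) yd zd => q; lra.
- move=> n y h; split.
    apply: Vcl => e /h [z [Vz _] yz]; exists (x - z) => //.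
    by rewrite opprB addrC addrA subrK nrmBC.
  apply/ler_addgt0Pr => e /h [z [_ zd] yz]; move: (_ + _^-1) zd => q zd.
  by have := nrm_triangle z y 0; rewrite !subr0; lra.
have yd : nrm y <= d.
  apply/ler_addgt0Pr => e e0.
  pose N := Num.truncn e^-1; have [_ yN] := yD N.
  apply: le_trans yN _; rewrite lerD2l ltW //.
  by rewrite -ltf_pV2 ?posrE ?inv0 // invrK; exact: truncnS_gt.
have [Vxy _] := yD 0%N; exists (x - y); split=> // v Vv; rewrite subKr.
set t := inner y v; apply: cabs_eq0.
have vv := nrm_ge0 v.
pose r : R := (1 + nrm v ^+ 2)^-1.
have r0 : 0 < r by rewrite invr_gt0 ltr_pwDl // sqr_ge0.
have rv : r * (1 + nrm v ^+ 2) = 1.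
  by rewrite mulVf // gt_eqF // ltr_pwDl // sqr_ge0.
(* A step of length [r t] from [x - y] along [v] decreases the distance to [x]
   unless [t = 0]. *)
have := dlb _ (clsubD cV Vxy (clsubZ (r%:C * t) cV Vv)).
rewrite opprD addrA subKr => h.
have h2 : nrm y ^+ 2 <= nrm (y - (r%:C * t) *: v) ^+ 2.
  by rewrite lerXn2r ?nnegrE ?nrm_ge0 // (le_trans yd).
move: h2; rewrite -scalerA !nrm_sq !reipE.
have -> : reip (t *: v) y = reip y (t *: v) by exact: reipC.
have -> : reip y (t *: v) = cabs t ^+ 2.
  by rewrite /reip ipZr conjM_cabs.
rewrite -(nrm_sq (t *: v)) nrmZ.
set q := cabs t => h2; have q0 : 0 <= q by exact: cabs_ge0.
apply/eqP; rewrite -sqrf_eq0; apply/eqP/le_anti; rewrite sqr_ge0 andbT.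
have h3 : 2 * (r * q ^+ 2) <= r * (r * nrm v ^+ 2) * q ^+ 2 by lra.
have h4 : r * nrm v ^+ 2 <= 1 by lra.
have h5 : r * (r * nrm v ^+ 2) * q ^+ 2 <= r * q ^+ 2.
  by rewrite ler_wpM2r ?sqr_ge0 // ger_pMr.
have h6 : r * q ^+ 2 <= 0 by lra.
by rewrite -(pmulr_rle0 _ r0).
Qed.

Lemma clsub_ominus W V : clsub W -> clsub (ominus W V).
Proof.
move=> [W0 WD Wc]; split=> [|a x y [Wx xV] [Wy yV]|x h].
- by split=> // v _; exact: ip0l.
- by split=> [|v Vv]; [exact: WD|rewrite ipDl ipZl xV // yV // mulr0 addr0].
- split=> [|v Vv]; first by apply: Wc => e /h [y [Wy _] xy]; exists y.
  apply: cabs_le_eq0 => e e0.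
  have v1 : 0 < nrm v + 1 by have := nrm_ge0 v; lra.
  have [y [_ yV] xy] := h _ (divr_gt0 e0 v1).
  have -> : inner x v = inner (x - y) v by rewrite ipBl yV // subr0.
  apply: le_trans (cabs_ip_le _ _) _.
  have := nrm_ge0 v; rewrite -[e](divfK (lt0r_neq0 v1)) => v0.
  by apply: ler_pM; rewrite ?nrm_ge0 //; lra.
Qed.

Lemma clsub_orthc V : clsub (orthc V). Proof. exact/clsub_ominus/clsubT. Qed.

Lemma orthc_self V x : V x -> orthc V x -> x = 0.
Proof. by move=> Vx [_ h]; apply/ip_eq0/h. Qed.

Lemma proj_in V x : clsub V -> V (proj V x).
Proof. by move=> cV; have [] := projP x cV. Qed.

Lemma proj_orth V x : clsub V -> orthc V (x - proj V x).
Proof. by move=> cV; have [_ h] := projP x cV. Qed.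

Lemma proj_unique V x p : clsub V -> V p -> orthc V (x - p) -> proj V x = p.
Proof.
move=> cV Vp ox; apply/subr0_eq.
apply: (@orthc_self V); first by apply: clsubB => //; exact: proj_in.
have -> : proj V x - p = (x - p) - (x - proj V x) by rewrite opprB [RHS]addrC addrA subrK.
by apply: clsubB => //; [exact: clsub_orthc|exact: proj_orth].
Qed.

Lemma proj_id V x : clsub V -> V x -> proj V x = x.
Proof.
move=> cV Vx; apply: proj_unique => //; rewrite subrr.
by have [] := clsub_orthc V.
Qed.

Lemma proj0 V x : clsub V -> orthc V x -> proj V x = 0.
Proof. by move=> cV Vx; apply: proj_unique; rewrite ?subr0 //; case: cV. Qed.

Lemma proj_pyth V x : clsub V ->
  nrm x ^+ 2 = nrm (proj V x) ^+ 2 + nrm (x - proj V x) ^+ 2.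
Proof.
move=> cV; have {1}-> : x = proj V x + (x - proj V x) by rewrite addrC subrK.
apply/nrm_pyth/ip_eq0C.
by have [_ h] := proj_orth x cV; apply: h; exact: proj_in.
Qed.

Lemma proj_nrm V x : clsub V -> nrm (proj V x) <= nrm x.
Proof.
move=> cV; rewrite -(@ler_pXn2r _ 2) ?nnegrE ?nrm_ge0 //.
by rewrite (proj_pyth x cV) lerDl sqr_ge0.
Qed.

Lemma projC_nrm V x : clsub V -> nrm (x - proj V x) <= nrm x.
Proof.
move=> cV; rewrite -(@ler_pXn2r _ 2) ?nnegrE ?nrm_ge0 //.
by rewrite [leRHS](proj_pyth x cV) lerDr sqr_ge0.
Qed.

Lemma proj_blin V : clsub V -> blin (proj V).
Proof.
move=> cV; have [_ VD _] := cV; split=> [a x y|]; last first.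
  by exists 1 => // x; rewrite mul1r proj_nrm.
apply: proj_unique => //; first by apply: VD; exact: proj_in.
rewrite opprD addrACA -scalerBr.
by have [_ oD _] := clsub_orthc V; apply: oD; exact: proj_orth.
Qed.

Lemma projC_blin V : clsub V -> blin (fun x => x - proj V x).
Proof.
move=> cV; have [pl _] := proj_blin cV; split=> [a x y|].
  by rewrite pl opprD addrACA -scalerBr.
by exists 1 => // x; rewrite mul1r projC_nrm.
Qed.

Lemma orthcK V x : clsub V -> orthc (orthc V) x -> V x.
Proof.
move=> cV xo; suff -> : x = proj V x by exact: proj_in.
apply/subr0_eq; apply: (@orthc_self (orthc V)); first exact: proj_orth.
apply: clsubB => //; first exact: clsub_orthc.
by split=> // v [_ ov]; apply/ip_eq0C/ov; exact: proj_in.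
Qed.

(** The residue [x - proj V x] lies in [ominus W V], hence is orthogonal to
    itself. *)
Lemma ominusK W V x : clsub V -> clsub W -> V `<=` W ->
  W x -> (forall w, ominus W V w -> inner x w = 0) -> V x.
Proof.
move=> cV cW VW Wx h; suff -> : x = proj V x by exact: proj_in.
apply/subr0_eq/ip_eq0.
have [_ po] := proj_orth x cV.
rewrite ipBl (ip_eq0C (po _ (proj_in _ cV))) subr0; apply: h.
by split=> //; apply: clsubB => //; apply: VW; exact: proj_in.
Qed.

Lemma riesz (phi : H -> R[i]) (M : R) :
  (forall a x y, phi (a *: x + y) = a * phi x + phi y) ->
  (forall x, cabs (phi x) <= M * nrm x) ->
  exists z, forall x, phi x = inner x z.
Proof.
move=> lphi bphi.
have phi0 : phi 0 = 0.
  by have := lphi (-1) 0 0; rewrite scaler0 addr0 mulN1r addNr.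
have phiB x y : phi (x - y) = phi x - phi y.
  by rewrite addrC -scaleN1r lphi mulN1r addrC.
pose N : set H := [set x | phi x = 0].
have cN : clsub N.
  split=> // [a x y xN yN|x h]; first by rewrite /N /= lphi xN yN mulr0 addr0.
  apply: cabs_le_eq0 => e e0.
  have M1 : 0 < `|M| + 1 by have := normr_ge0 M; lra.
  have [y yN xy] := h _ (divr_gt0 e0 M1).
  have -> : phi x = phi (x - y) by rewrite phiB yN subr0.
  apply: le_trans (bphi _) _.
  rewrite -[e](divfK (lt0r_neq0 M1)) [leRHS]mulrC.
  apply: le_trans (_ : (`|M| + 1) * nrm (x - y) <= _).
    by rewrite ler_wpM2r ?nrm_ge0 //; have := ler_norm M; lra.
  by rewrite ler_wpM2l //; [lra|exact: ltW].
have [[x0 x0N]|allN] := pselect (exists x0, phi x0 <> 0); last first.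
  exists 0 => x; rewrite ip0r; apply: contrapT => h; apply: allN.
  by exists x.
pose u := x0 - proj N x0.
have uo : orthc N u by exact: proj_orth.
have phiu : phi u <> 0.
  by have Np : phi (proj N x0) = 0 := proj_in x0 cN; rewrite phiB Np subr0.
have uu : inner u u != 0.
  by apply/eqP => /ip_eq0 h; apply: phiu; rewrite h.
exists ((phi u / inner u u)^*%C *: u) => x.
have := uo.2 (phi x *: u - phi u *: x).
rewrite /N /= phiB.
have phiZ a y : phi (a *: y) = a * phi y by rewrite -[a *: y]addr0 lphi phi0 addr0.
rewrite !phiZ mulrC subrr => /(_ erefl)/ip_eq0C.
rewrite ipBl !ipZl => /subr0_eq h.
rewrite ipZr conjCK; apply: (mulIf uu).
by rewrite h mulrAC divfK // mulrC.
Qed.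

End Subspace.

Section BoundedLinear.
Context {R : realType}.
Implicit Types (H K L : hilbertType R).

Lemma blin0 H K (f : H -> K) : blin f -> f 0 = 0.
Proof.
by move=> [fl _]; have := fl (-1) 0 0; rewrite scaler0 addr0 scaleN1r addNr.
Qed.

Lemma blinZ H K (f : H -> K) a x : blin f -> f (a *: x) = a *: f x.
Proof. by move=> bf; rewrite -[a *: x]addr0 bf.1 blin0 // addr0. Qed.

Lemma blinD H K (f : H -> K) x y : blin f -> f (x + y) = f x + f y.
Proof. by move=> bf; rewrite -[x]scale1r bf.1 !scale1r. Qed.

Lemma blinN H K (f : H -> K) x : blin f -> f (- x) = - f x.
Proof. by move=> bf; rewrite -scaleN1r blinZ // scaleN1r. Qed.

Lemma blinB H K (f : H -> K) x y : blin f -> f (x - y) = f x - f y.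
Proof. by move=> bf; rewrite blinD // blinN. Qed.

Lemma blin_sum H K (f : H -> K) n (c : 'I_n -> R[i]) (x : 'I_n -> H) :
  blin f -> f (\sum_i c i *: x i) = \sum_i c i *: f (x i).
Proof.
move=> bf; elim/big_rec2: _ => [|i u v _ <-]; first exact: blin0.
by rewrite bf.1.
Qed.

Lemma blin_id H : blin (@id H).
Proof. by split=> //; exists 1 => // x; rewrite mul1r. Qed.

Lemma blin_comp H K L (f : K -> L) (g : H -> K) : blin f -> blin g -> blin (f \o g).
Proof.
move=> [fl [M M0 fM]] [gl [N N0 gN]]; split=> [a x y|]; first by rewrite /= gl fl.
exists (M * N); first exact: mulr_ge0.
move=> x /=; apply: le_trans (fM _) _.
by rewrite -mulrA ler_wpM2l.
Qed.

Lemma blin_add H K (f g : H -> K) : blin f -> blin g -> blin (fun x => f x + g x).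
Proof.
move=> [fl [M M0 fM]] [gl [N N0 gN]]; split=> [a x y|].
  by rewrite fl gl scalerDr addrACA.
exists (M + N); first exact: addr_ge0.
by move=> x; apply: le_trans (nrmD _ _) _; rewrite mulrDl lerD.
Qed.

Lemma blin_scale H K (f : H -> K) a : blin f -> blin (fun x => a *: f x).
Proof.
move=> [fl [M M0 fM]]; split=> [b x y|].
  by rewrite fl scalerDr !scalerA mulrC.
exists (cabs a * M); first by rewrite mulr_ge0 ?cabs_ge0.
by move=> x; rewrite nrmZ -mulrA ler_wpM2l ?cabs_ge0.
Qed.

Lemma adjP H K (f : H -> K) x y : blin f -> inner (f x) y = inner x (adj f y).
Proof.
move=> [fl [M M0 fM]].
have [||z zP] := @riesz R H (fun x => inner (f x) y) (M * nrm y).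
- by move=> a u v; rewrite fl ipDl ipZl.
- move=> u; apply: le_trans (cabs_ip_le _ _) _.
  by rewrite mulrAC ler_wpM2r ?nrm_ge0.
move: x; apply: (@getPex _ [set z | forall x, inner (f x) y = inner x z]).
by exists z.
Qed.

Lemma adjP' H K (f : H -> K) x y : blin f -> inner (adj f y) x = inner y (f x).
Proof. by move=> bf; rewrite ipC -adjP // -ipC. Qed.

Lemma adj_blin H K (f : H -> K) : blin f -> blin (adj f).
Proof.
move=> bf; have [fl [M M0 fM]] := bf; split.
  by move=> a x y; apply: nrm_eq_ip => z; rewrite ipDl ipZl !adjP' // ipDl ipZl.
exists M => // y.
have [->|/nrm_gt0 n0] := pselect (adj f y = 0).
  by rewrite nrm0 mulr_ge0 ?nrm_ge0.
rewrite -(ler_pM2l n0) -expr2 nrm_sq /reip adjP' // -/(reip y (f (adj f y))).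
apply: le_trans (reip_le _ _) _; rewrite mulrC mulrCA mulrA.
by rewrite ler_wpM2r ?nrm_ge0.
Qed.

Lemma clsub_preimage H K (f : H -> K) (V : set K) :
  blin f -> clsub V -> clsub (f @^-1` V).
Proof.
move=> bf [V0 VD Vc]; have [fl [M M0 fM]] := bf; split=> [|a x y Vx Vy|x h].
- by rewrite /preimage /= blin0.
- by rewrite /preimage /= fl; exact: VD.
- apply: Vc => e e0.
  have M1 : 0 < M + 1 by lra.
  have [y Vy xy] := h _ (divr_gt0 e0 M1); exists (f y) => //.
  rewrite -blinB //; apply: le_lt_trans (fM _) _.
  apply: le_lt_trans (_ : (M + 1) * nrm (x - y) < _).
    by rewrite ler_wpM2r ?nrm_ge0 //; lra.
  by rewrite mulrC -ltr_pdivlMr.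
Qed.

End BoundedLinear.

(** * Hilbert space dimension *)

Lemma card_eq_split (T U : Type) (V : pointedType) (A : set T) (C : set U)
    (B : set V) :
  B #= A #+ C -> exists X, [/\ X `<=` B, X #= A & B `\` X #= C].
Proof.
rewrite card_eq_sym => /card_set_bijP[f [fB finj fsurj]].
have Ai a : A a -> (A #+ C) (inl a) by move=> Aa; left; exists a.
have Ci c : C c -> (A #+ C) (inr c) by move=> Cc; right; exists c.
exists [set f (inl a) | a in A]; split.
- by move=> _ [a Aa <-]; apply: fB; exact: Ai.
- apply: inj_card_eq => a a' /set_mem Aa /set_mem Aa' e.
  have := finj (inl a) (inl a') (mem_set (Ai _ Aa)) (mem_set (Ai _ Aa')) e.
  by case.
- rewrite card_eq_sym; have -> : B `\` [set f (inl a) | a in A] = [set f (inr c) | c in C].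
    apply/seteqP; split=> [b [Bb nb]|_ [c Cc <-]].
      have [_ [[a Aa <-]|[c Cc <-]] eb] := fsurj _ Bb; last by exists c.
      by exfalso; apply: nb; exists a.
    split; first exact/fB/Ci.
    move=> [a Aa e].
    by have := finj (inl a) (inr c) (mem_set (Ai _ Aa)) (mem_set (Ci _ Cc)) e.
  rewrite card_eq_sym; apply: inj_card_eq => c c' /set_mem Cc /set_mem Cc' e.
  have := finj (inr c) (inr c') (mem_set (Ci _ Cc)) (mem_set (Ci _ Cc')) e.
  by case.
Qed.

Section Bases.
Context {R : realType} {H : hilbertType R}.
Implicit Types (V W B X : set H) (x y z : H).

Lemma onb_exists V : orthonormal_basis V (hdim V).
Proof.
apply: (@getPex _ (orthonormal_basis V)).
pose P B := B `<=` V /\ orthonormal_set B.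
have [|B [[BV oB] Bmax]] := @Zorn_bigcup H P.
  move=> F FP tot; split=> [x [B FB Bx]|x y [B FB Bx] [B' FB' By]].
    by have [h _] := FP _ FB; exact: h.
  have [sub|sub] := tot _ _ FB FB'.
    by have [_] := FP _ FB'; apply => //; exact: sub.
  by have [_] := FP _ FB; apply => //; exact: sub.
exists B; split=> // B' B'V oB' BB'; apply: contrapT => neq.
apply: (Bmax B') => //; split=> // B'B; apply: neq.
exact/seteqP.
Qed.

Lemma orthonormal_nrm X x : orthonormal_set X -> X x -> nrm x = 1.
Proof.
move=> oX Xx; have := oX _ _ Xx Xx; rewrite eqxx nrm_sqC => /(congr1 (@complex.Re R)) /=.
move=> h; apply/eqP; rewrite -(@eqrXn2 _ 2) ?nrm_ge0 ?ler01 // expr1n; exact/eqP.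
Qed.

Lemma onb_eq0 V B x : clsub V -> orthonormal_basis V B -> V x ->
  (forall b, B b -> inner x b = 0) -> x = 0.
Proof.
move=> cV [BV oB Bmax] Vx xB; apply: contrapT => x0.
have nx : nrm x != 0 by apply/eqP => /nrm_eq0.
pose u := ((nrm x)^-1)%:C *: x.
have nu : inner u u = 1.
  rewrite nrm_sqC nrmZr ?invr_ge0 ?nrm_ge0 // mulVf // expr1n.
  by rewrite rmorph1.
have uB b : B b -> inner u b = 0 by move=> Bb; rewrite ipZl xB // mulr0.
have nuB : ~ B u by move=> Bu; move: nu; rewrite uB // => /eqP; rewrite eq_sym oner_eq0.
apply: nuB; rewrite -(Bmax (B `|` [set u])); [by right|..].
- by move=> y [/BV//|->]; exact: clsubZ.
- move=> y z [By|->] [Bz|->].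
  + exact: oB.
  + rewrite ip_eq0C ?uB //; case: eqVneq => // e; exfalso.
    by move: nu; rewrite -{1}e ip_eq0C ?uB // => /eqP; rewrite eq_sym oner_eq0.
  + rewrite uB //; case: eqVneq => // e; exfalso.
    by move: nu; rewrite {2}e uB // => /eqP; rewrite eq_sym oner_eq0.
  + by rewrite nu eqxx.
- by move=> y; left.
Qed.

Lemma onb_orth V B z : clsub V -> orthonormal_basis V B ->
  (forall b, B b -> inner z b = 0) -> forall v, V v -> inner z v = 0.
Proof.
move=> cV bB zB v Vv; have [_ po] := projP z cV.
have p0 : proj V z = 0.
  apply: (onb_eq0 cV bB) => [|b Bb]; first exact: proj_in.
  have [BV _ _] := bB; have := po _ (BV _ Bb).
  by rewrite ipBl zB // sub0r => /eqP; rewrite oppr_eq0 => /eqP.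
by rewrite -(po _ Vv) p0 subr0.
Qed.

Lemma orthonormal_basisI V B : B `<=` V -> orthonormal_set B ->
  (forall x, V x -> (forall b, B b -> inner x b = 0) -> x = 0) ->
  orthonormal_basis V B.
Proof.
move=> BV oB B0; split=> // B' B'V oB' BB'; apply/seteqP; split=> // x B'x.
apply: contrapT => nBx; have x0 : x = 0.
  apply: B0 => [|b Bb]; first exact: B'V.
  rewrite (oB' _ _ B'x (BB' _ Bb)); case: eqVneq => // e.
  by exfalso; apply: nBx; rewrite e.
have := orthonormal_nrm oB' B'x; rewrite x0 nrm0 => /eqP.
by rewrite eq_sym oner_eq0.
Qed.

Lemma bessel X (s : seq H) y : orthonormal_set X -> uniq s ->
  (forall x, x \in s -> X x) ->
  \sum_(x <- s) cabs (inner x y) ^+ 2 <= nrm y ^+ 2.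
Proof.
move=> oX; elim: s y => [|x s ih] y; first by rewrite big_nil sqr_ge0.
rewrite cons_uniq => /andP[xs us] sX; rewrite big_cons.
have Xx : X x by apply: sX; rewrite mem_head.
have nx := orthonormal_nrm oX Xx.
pose y' := y - inner y x *: x.
have xy' : inner x y' = 0.
  rewrite ipBr ipZr nrm_sqC nx expr1n rmorph1 mulr1 (ipC y x).
  by apply/eqP; rewrite subr_eq0; exact/eqP.
have -> : nrm y ^+ 2 = cabs (inner x y) ^+ 2 + nrm y' ^+ 2.
  have {1}-> : y = inner y x *: x + y' by rewrite addrC subrK.
  rewrite nrm_pyth; last by rewrite ipZl xy' mulr0.
  by rewrite nrmZ nx mulr1 (ipC y x) -(cabs_conj (inner y x)).
rewrite lerD2l (_ : \sum_(z <- s) _ = \sum_(z <- s) cabs (inner z y') ^+ 2).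
  by apply: ih => // z zs; apply: sX; rewrite in_cons zs orbT.
rewrite big_seq [RHS]big_seq; apply: eq_bigr => z zs.
rewrite ipBr ipZr (oX z x) //; last by apply: sX; rewrite in_cons zs orbT.
case: eqVneq => [e|_]; last by rewrite mulr0 subr0.
by move: xs; rewrite -e zs.
Qed.

(** Only finitely many coefficients of [y] have a squared modulus of at least
    [1 / (k + 1)]. *)
Lemma countable_support X y : orthonormal_set X ->
  countable [set x | X x /\ inner x y <> 0].
Proof.
move=> oX; pose S (k : nat) := [set x | X x /\ k.+1%:R^-1 <= cabs (inner x y) ^+ 2].
apply: sub_countable (_ : countable (\bigcup_(k in [set: nat]) S k)).
  apply: subset_card_le => x [Xx xy].
  have p0 : 0 < cabs (inner x y) ^+ 2.
    rewrite exprn_gt0 // lt_def cabs_ge0 andbT.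
    by apply/eqP => /cabs_eq0.
  exists (Num.truncn (cabs (inner x y) ^+ 2)^-1) => //; split=> //.
  rewrite -[leRHS]invrK lef_pV2 ?posrE ?ltr0n ?invr_gt0 //.
  by apply/ltW/truncnS_gt.
apply: bigcup_countable => [|k _]; first exact: countableP.
apply: finite_set_countable; apply: contrapT => /infiniteP/card_le_relP[r [r1 r2]].
have /choice[g gP] : forall n, exists x, S k x /\ r n x.
  by move=> n; have [x] := r1 n I; exists x.
have ginj : injective g.
  move=> i j e; apply: (r2 i j (g i)) => //; first by have [] := gP i.
  by rewrite e; have [] := gP j.
pose N := (Num.truncn (k.+1%:R * nrm y ^+ 2)).+1.
have := @bessel X (map g (iota 0 N)) y oX.
rewrite map_inj_uniq // iota_uniq => /(_ isT).
have sX x : x \in map g (iota 0 N) -> X x.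
  by move=> /mapP[i _ ->]; have [[]] := gP i.
move=> /(_ sX); apply/negP; rewrite -ltNge.
apply: lt_le_trans (_ : N%:R * k.+1%:R^-1 <= _).
  by rewrite ltr_pdivlMr ?ltr0n // mulrC truncnS_gt.
rewrite big_map.
have -> : N%:R * k.+1%:R^-1 = \sum_(j <- iota 0 N) k.+1%:R^-1 :> R.
  by rewrite big_const_seq count_predT size_iota iter_addr_0 mulr_natl.
apply: ler_sum => i _.
by have [[_]] := gP i.
Qed.

Lemma orthonormal_indep X n (e : 'I_n -> H) (c : 'I_n -> R[i]) :
  orthonormal_set X -> injective e -> (forall i, X (e i)) ->
  forall i, inner (\sum_j c j *: e j) (e i) = c i.
Proof.
move=> oX einj eX i; rewrite nrm_suml (bigD1 i) //= big1 ?addr0.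
  by rewrite oX // eqxx mulr1.
by move=> j ji; rewrite oX // (inj_eq einj) (negPf ji) mulr0.
Qed.

End Bases.

Section Dimension.
Context {R : realType}.
Implicit Types (H K L : hilbertType R).

(** The entries of a nondegenerate bounded pairing between two bases form a
    matrix whose rows are independent, and whose columns are countable by
    the inequality of Bessel. *)
Lemma onb_card_le_pairing H K (f : H -> K) (V : set H) (W : set K) X Y :
  blin f -> clsub V -> clsub W ->
  orthonormal_basis V X -> orthonormal_basis W Y ->
  (forall x, V x -> (forall w, W w -> inner (f x) w = 0) -> x = 0) ->
  X #<= Y.
Proof.
move=> bf cV cW bX bY nd; have [XV oX _] := bX; have [YW oY _] := bY.
apply: (@card_le_matrix R[i] _ _ X Y (fun x y => inner (f x) y)).
  move=> y Yy; have := countable_support (adj f y) oX.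
  apply: sub_countable; apply: subset_card_le => x [Xx] h; split=> //.
  by rewrite -adjP.
move=> n e c einj eX h i; set z := \sum_i c i *: e i.
suff z0 : z = 0 by rewrite -(orthonormal_indep c oX einj eX i) -/z z0 ip0l.
have Vz : V z.
  rewrite /z; elim/big_rec: _ => [|j u _ Vu]; first by case: cV.
  by have [_ VD _] := cV; apply: VD => //; apply: XV.
apply: nd => // w Ww; apply: (onb_orth cW bY) Ww => y Yy.
by rewrite /z blin_sum // nrm_suml h.
Qed.

Lemma hdim_onb H (V : set H) B : clsub V -> orthonormal_basis V B -> hdim V #= B.
Proof.
move=> cV bB; have bV := onb_exists V.
by apply: card_le_sym; apply: (onb_card_le_pairing (@blin_id R H) cV cV) => // x Vx h;
  apply: ip_eq0; apply: h.
Qed.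

Lemma hdim_le_pairing H K (f : H -> K) (V : set H) (W : set K) :
  blin f -> clsub V -> clsub W ->
  (forall x, V x -> (forall w, W w -> inner (f x) w = 0) -> x = 0) ->
  hdim V #<= hdim W.
Proof.
move=> bf cV cW; apply: (onb_card_le_pairing bf) => //; exact: onb_exists.
Qed.

Lemma hdim_ge_pairing H K (f : H -> K) (V : set H) (W : set K) :
  blin f -> clsub V -> clsub W ->
  (forall w, W w -> (forall x, V x -> inner (f x) w = 0) -> w = 0) ->
  hdim W #<= hdim V.
Proof.
move=> bf cV cW nd; apply: (@hdim_le_pairing _ _ (adj f)) => //.
  exact: adj_blin.
by move=> w Ww h; apply: nd => // x Vx; rewrite adjP //; exact/ip_eq0C/h.
Qed.

Lemma hdim_eq_pairing H K (f : H -> K) (V : set H) (W : set K) :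
  blin f -> clsub V -> clsub W ->
  (forall x, V x -> (forall w, W w -> inner (f x) w = 0) -> x = 0) ->
  (forall w, W w -> (forall x, V x -> inner (f x) w = 0) -> w = 0) ->
  hdim V #= hdim W.
Proof.
move=> bf cV cW nd1 nd2; apply: card_le_sym.
  exact: (hdim_le_pairing bf).
exact: (hdim_ge_pairing bf).
Qed.

Lemma hdim_sub H (V W : set H) : clsub V -> clsub W -> V `<=` W ->
  hdim V #<= hdim W.
Proof.
move=> cV cW VW; apply: (hdim_le_pairing (@blin_id R H)) => // x Vx h.
by apply/ip_eq0/h/VW.
Qed.

Lemma hdim_ominus H (V W : set H) : clsub V -> clsub W -> W `<=` V ->
  hdim V #= hdim W #+ hdim (ominus V W).
Proof.
move=> cV cW WV.
have [BW oW Wmax] := onb_exists W; have bW := onb_exists W.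
have [BO oO Omax] := onb_exists (ominus V W); have bO := onb_exists (ominus V W).
have WO x y : hdim W x -> hdim (ominus V W) y -> inner y x = 0.
  by move=> Wx /BO[_]; apply; exact: BW.
have dis x : hdim W x -> hdim (ominus V W) x -> False.
  move=> Wx Ox; have := orthonormal_nrm oW Wx.
  by rewrite (ip_eq0 (WO _ _ Wx Ox)) nrm0 => /eqP; rewrite eq_sym oner_eq0.
apply: card_eq_trans (card_setU_disjoint dis).
apply: hdim_onb => //; apply: orthonormal_basisI.
- by move=> x [/BW/WV//|/BO[]].
- move=> x y [Wx|Ox] [Wy|Oy].
  + exact: oW.
  + rewrite (ip_eq0C (WO _ _ Wx Oy)); case: eqVneq => // e; exfalso.
    by apply: (dis x) => //; rewrite e.
  + rewrite WO //; case: eqVneq => // e; exfalso.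
    by apply: (dis y) => //; rewrite -e.
  + exact: oO.
- move=> x Vx h.
  apply: (onb_eq0 (clsub_ominus W cV) bO) => [|b Bb]; last by apply: h; right.
  by split=> //; apply: (onb_orth cW bW) => b Bb; apply: h; left.
Qed.

Lemma hdim_split H (T U : Type) (A : set T) (C : set U) (V : set H) :
  clsub V -> hdim V #= A #+ C ->
  exists W, [/\ clsub W, W `<=` V, hdim W #= A & hdim (ominus V W) #= C].
Proof.
move=> cV /card_eq_split[X [XB XA XC]].
have bV := onb_exists V; have [BV oB _] := bV.
pose W := ominus V (hdim V `\` X).
have cW : clsub W by exact: clsub_ominus.
have XW : X `<=` W.
  move=> x Xx; split=> [|y [By nXy]]; first exact/BV/XB.
  by rewrite oB //; [case: eqVneq => // e; exfalso; apply: nXy; rewrite -e|exact: XB].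
have WV : W `<=` V by move=> x [].
have oX : orthonormal_set X by move=> x y Xx Xy; apply: oB; exact: XB.
exists W; split=> //.
  apply: card_eq_trans XA; apply: hdim_onb => //; apply: orthonormal_basisI => // x [Vx xo] xX.
  apply: (onb_eq0 cV bV) => // b Bb.
  by have [Xb|nXb] := pselect (X b); [exact: xX|exact: xo].
apply: card_eq_trans XC; apply: hdim_onb; first exact: clsub_ominus.
apply: orthonormal_basisI.
- move=> x [Bx nXx]; split; first exact: BV.
  by move=> w [Vw wo]; apply/ip_eq0C/wo.
- by move=> x y [Bx _] [By _]; exact: oB.
- move=> x [Vx xW] xB; apply: (onb_eq0 cV bV) => // b Bb.
  have [Xb|nXb] := pselect (X b); last exact: xB.
  exact/xW/XW.
Qed.

End Dimension.

(** * Unitary equivalence of closed subspaces of equal dimension *)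

Section Unitary.
Context {R : realType}.
Implicit Types (H K : hilbertType R).

(** Relations, unlike functions, treat a correspondence of two bases and its
    inverse alike. *)
Inductive span_rel H K (r : H -> K -> Prop) : H -> K -> Prop :=
| span_rel0 : span_rel r 0 0
| span_relS (a : R[i]) e e' x y : r e e' -> span_rel r x y ->
    span_rel r (a *: e + x) (a *: e' + y).

Definition cl_rel H K (r : H -> K -> Prop) (x : H) (y : K) : Prop :=
  forall d : R, 0 < d -> exists x' y',
    [/\ span_rel r x' y', nrm (x - x') < d & nrm (y - y') < d].

Definition isometric_rel H K (r : H -> K -> Prop) : Prop :=
  forall e e' f f', r e e' -> r f f' -> inner e f = inner e' f'.

Lemma span_rel_ip H K (r : H -> K -> Prop) x y x' y' : isometric_rel r ->
  span_rel r x y -> span_rel r x' y' -> inner x x' = inner y y'.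
Proof.
move=> ir; elim=> [|a e e' u v ree' _ ih] s; first by rewrite !ip0l.
rewrite !ipDl !ipZl (ih s); congr (_ * _ + _).
elim: s => [|b f f' w z rff' _ ih']; first by rewrite !ip0r.
by rewrite !ipDr !ipZr ih' (ir _ _ _ _ ree' rff').
Qed.

Lemma span_rel_lin H K (r : H -> K -> Prop) a x y x' y' :
  span_rel r x y -> span_rel r x' y' -> span_rel r (a *: x + x') (a *: y + y').
Proof.
move=> s s'; elim: s => [|b e e' u v ree' _ ih]; first by rewrite !scaler0 !add0r.
by rewrite !scalerDr !scalerA -!addrA; exact: span_relS.
Qed.

Lemma span_rel_sym H K (r : H -> K -> Prop) x y :
  span_rel r x y -> span_rel (fun y x => r x y) y x.
Proof. by elim=> [|a e e' u v h _ ih]; constructor. Qed.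

Lemma cl_rel_sym H K (r : H -> K -> Prop) x y :
  cl_rel r x y -> cl_rel (fun y x => r x y) y x.
Proof.
move=> h d /h[x' [y' [s xx' yy']]]; exists y', x'; split=> //.
exact: span_rel_sym.
Qed.

Lemma cl_rel_lin H K (r : H -> K -> Prop) a x y x' y' :
  cl_rel r x y -> cl_rel r x' y' -> cl_rel r (a *: x + x') (a *: y + y').
Proof.
move=> h h' d d0; pose c := cabs a + 1.
have c0 : 0 < c by rewrite ltr_wpDl ?cabs_ge0.
have d20 : 0 < d / 2 by rewrite divr_gt0.
have [u [v [s xu yv]]] := h _ (divr_gt0 d20 c0).
have [u' [v' [s' xu' yv']]] := h' _ d20.
have bound (q : R) : 0 <= q -> q < d / 2 / c -> cabs a * q < d / 2.
  move=> q0; rewrite ltr_pdivlMr // => qd; apply: le_lt_trans qd.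
  by rewrite mulrC ler_wpM2l // lerDl.
exists (a *: u + u'), (a *: v + v'); split; first exact: span_rel_lin.
- rewrite opprD addrACA -scalerBr; apply: le_lt_trans (nrmD _ _) _.
  by rewrite nrmZ; have := bound _ (nrm_ge0 _) xu; lra.
- rewrite opprD addrACA -scalerBr; apply: le_lt_trans (nrmD _ _) _.
  by rewrite nrmZ; have := bound _ (nrm_ge0 _) yv; lra.
Qed.

Lemma cl_rel_nrm H K (r : H -> K -> Prop) x y : isometric_rel r ->
  cl_rel r x y -> nrm x = nrm y.
Proof.
move=> ir h.
have e d : 0 < d -> nrm x <= nrm y + d /\ nrm y <= nrm x + d.
  move=> d0; have [x' [y' [s xx' yy']]] := h _ (divr_gt0 d0 (ltr0n R 2)).
  have xy' : nrm x' = nrm y'.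
    exact/nrm_ip_eq/(span_rel_ip ir s s).
  have := nrm_triangle x' x 0; have := nrm_triangle y y' 0.
  have := nrm_triangle x x' 0; have := nrm_triangle y' y 0.
  by rewrite !subr0 (nrmBC y' y) (nrmBC x' x); lra.
by apply/le_anti/andP; split; apply/ler_addgt0Pr => d /e[].
Qed.

(** Along an isometric relation, approximations of [x] have Cauchy images, so
    that the domain of [cl_rel r] is closed. *)
Lemma cl_rel_total H K (r : H -> K -> Prop) (V X : set H) :
  isometric_rel r -> clsub V -> orthonormal_basis V X ->
  (forall e e', r e e' -> X e) -> (forall e, X e -> exists e', r e e') ->
  forall x, V x <-> exists y, cl_rel r x y.
Proof.
move=> ir cV bX rX Xr; have [XV _ _] := bX; have [V0 VD Vcl] := cV.
pose D : set H := [set x | exists y, cl_rel r x y].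
have DV : D `<=` V.
  move=> x [y xy]; apply: Vcl => d /xy[x' [y' [s xx' _]]]; exists x' => //.
  by elim: s => [//|a e e' u v ree' _ ih]; apply: VD => //; apply/XV/rX/ree'.
have cD : clsub D.
  split=> [|a x x' [y xy] [y' xy']|x h].
  - by exists 0 => d d0; exists 0, 0; rewrite subrr nrm0 subrr nrm0; split=> //; exact: span_rel0.
  - by exists (a *: y + y'); exact: cl_rel_lin.
  - have [u /choice[v uv] small] := approx_seq h.
    have [|y yP] := @cauchy_nrm R K v.
      move=> e e0; have [N NP] := small _ (divr_gt0 e0 (ltr0n R 2)).
      exists N => m n Nm Nn; have := cl_rel_lin (-1) (uv n) (uv m).
      rewrite !scaleN1r !(addrC (- _)) => /(cl_rel_nrm ir) <-.
      apply: le_lt_trans (nrm_triangle x _ _) _.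
      by rewrite nrmBC; have := NP _ Nm; have := NP _ Nn; lra.
    exists y => d d0; have d20 := divr_gt0 d0 (ltr0n R 2).
    have [N NP] := small _ d20; have [N' NP'] := yP _ d20.
    have [x' [y' [s xx' yy']]] := uv (maxn N N') _ d20.
    exists x', y'; split=> //.
      apply: le_lt_trans (nrm_triangle (u (maxn N N')) _ _) _.
      by have := NP _ (leq_maxl N N'); lra.
    apply: le_lt_trans (nrm_triangle (v (maxn N N')) _ _) _.
    by have := NP' _ (leq_maxr N N'); lra.
move=> x; split=> [Vx|/DV//].
apply: (ominusK cD cV DV Vx) => w [Vw wD].
suff -> : w = 0 by rewrite ip0r.
apply: (onb_eq0 cV bX) => // b Xb; apply: wD.
have [b' rb] := Xr _ Xb; exists b' => d d0; exists b, b'.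
rewrite !subrr !nrm0; split=> //.
by have := span_relS 1 rb (span_rel0 r); rewrite !scale1r !addr0.
Qed.

(** The correspondence of two bases extends to the closure of its span. *)
Lemma hdim_unitary H K (V : set H) (W : set K) :
  clsub V -> clsub W -> hdim V #= hdim W ->
  exists U : H -> K, [/\ blin U, forall x, V x -> W (U x),
    forall w, W w -> exists2 x, V x & U x = w &
    forall x y, V x -> V y -> inner (U x) (U y) = inner x y].
Proof.
move=> cV cW /card_set_bijP[f [fW finj fsurj]].
have bV := onb_exists V; have bW := onb_exists W.
have [_ oV _] := bV; have [_ oW _] := bW.
pose r x y := hdim V x /\ y = f x.
have ir : isometric_rel r.
  move=> e e' g g' [Ve ->] [Vg ->]; rewrite oV // oW; try exact: fW.
  congr (_%:R); congr nat_of_bool; apply/eqP/eqP => [->//|h].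
  by apply: finj; rewrite ?inE.
have Vtot := @cl_rel_total _ _ r V _ ir cV bV (fun e e' h => h.1)
  (fun e Ve => ex_intro _ (f e) (conj Ve erefl)).
have Wtot := @cl_rel_total _ _ (fun y x => r x y) W (hdim W).
have {}Wtot : forall y, W y <-> exists x, cl_rel r x y.
  move=> y; rewrite Wtot //.
  - by split=> -[x h]; exists x; [apply: cl_rel_sym h|exact: cl_rel_sym].
  - by move=> e e' g g' h h'; rewrite (ir _ _ _ _ h h').
  - by move=> e e' [Ve ->]; exact: fW.
  - by move=> e /fsurj[x Vx <-]; exists x.
have fun_rel x y y' : cl_rel r x y -> cl_rel r x y' -> y = y'.
  move=> h h'; have := cl_rel_nrm ir (cl_rel_lin (-1) h' h).
  rewrite !scaleN1r addNr nrm0 addrC => /esym/nrm_eq0/subr0_eq; exact.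
have /choice[g gP] : forall x, exists y, cl_rel r (proj V x) y.
  by move=> x; apply/Vtot; exact: proj_in.
have gV x : V x -> cl_rel r x (g x).
  by move=> Vx; have := gP x; rewrite proj_id.
have bg : blin g.
  have [pl _] := proj_blin cV; split=> [a x y|].
    by apply: fun_rel (gP _) _; rewrite pl; exact: cl_rel_lin.
  by exists 1 => // x; rewrite mul1r -(cl_rel_nrm ir (gP x)) proj_nrm.
have gn x : V x -> nrm (g x) = nrm x by move=> /gV/(cl_rel_nrm ir).
exists g; split=> //.
- by move=> x _; apply/Wtot; exists (proj V x).
- move=> w /Wtot[x xw]; have Vx : V x by apply/Vtot; exists w.
  by exists x => //; apply: fun_rel (gV _ Vx) xw.
- have re x y : V x -> V y -> reip (g x) (g y) = reip x y.
    move=> Vx Vy; have := gn _ (clsubD cV Vx Vy).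
    move=> /(congr1 (fun q => q ^+ 2)); rewrite blinD // !nrm_sq !reipE.
    rewrite -!nrm_sq !gn // (reipC (g x)) (reipC x y).
    by lra.
  move=> x y Vx Vy; have := re _ _ Vx Vy.
  (* The imaginary part of [inner x y] is the real part of [inner x (i y)]. *)
  have := re _ _ Vx (clsubZ 'i%C cV Vy).
  rewrite blinZ // /reip !ipZr.
  case: (inner (g x) (g y)) => a b; case: (inner x y) => c d /=.
  by rewrite !mul0r !mulN1r !sub0r !opprK => -> ->.
Qed.

End Unitary.

(** * Operators bounded below on a closed subspace *)

Section BoundedBelow.
Context {R : realType}.
Implicit Types (H K : hilbertType R).

Definition bounded_below H K (f : H -> K) (V : set H) : Prop :=
  exists2 c : R, 0 < c & forall x, V x -> c * nrm x <= nrm (f x).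

Lemma bounded_below_inj H K (f : H -> K) V x :
  bounded_below f V -> V x -> f x = 0 -> x = 0.
Proof.
move=> [c c0 fV] Vx fx; apply: nrm_eq0; have := fV _ Vx.
rewrite fx nrm0 pmulr_rle0 // => h; apply/le_anti.
by rewrite h nrm_ge0.
Qed.

Lemma bounded_below_image H K (f : H -> K) V :
  blin f -> clsub V -> bounded_below f V -> clsub (f @` V).
Proof.
move=> bf cV [c c0 fV]; have [V0 VD Vcl] := cV.
have [fl [M M0 fM]] := bf; split=> [|a _ _ [x Vx <-] [y Vy <-]|y h].
- by exists 0 => //; exact: blin0.
- by exists (a *: x + y); [exact: VD|rewrite fl].
- have [w wV small] := approx_seq h.
  have /choice[u uP] : forall n, exists x, V x /\ f x = w n.
    by move=> n; have [x Vx fx] := wV n; exists x.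
  have [|x xP] := @cauchy_nrm R H u.
    move=> e e0; have ec0 : 0 < c * e / 2 by rewrite divr_gt0 ?mulr_gt0.
    have [N NP] := small _ ec0.
    exists N => m n Nm Nn; rewrite -(ltr_pM2l c0).
    apply: le_lt_trans (fV _ (clsubB cV (uP m).1 (uP n).1)) _.
    rewrite blinB // !(uP _).2; apply: le_lt_trans (nrm_triangle y _ _) _.
    by rewrite nrmBC; have := NP _ Nm; have := NP _ Nn; lra.
  have Vx : V x.
    by apply: Vcl => e /xP[N NP]; exists (u N); [have [] := uP N|exact: NP].
  exists x => //; apply/subr0_eq/nrm_eq0/le_anti; rewrite nrm_ge0 andbT.
  apply/ler_addgt0Pr => e e0; rewrite add0r.
  have M1 : 0 < M + 1 by lra.
  have e20 := divr_gt0 e0 (ltr0n R 2).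
  have [N NP] := small _ e20; have [N' NP'] := xP _ (divr_gt0 e20 M1).
  set m := maxn N N'.
  apply: le_trans (nrm_triangle (f (u m)) _ _) _; rewrite -blinB //.
  have := fM (x - u m); have := NP' m (leq_maxr _ _).
  rewrite ltr_pdivlMr // (nrmBC (f (u m))) => h1 h2.
  have := NP m (leq_maxl _ _); rewrite -(uP m).2; have := nrm_ge0 (x - u m); rewrite mulrDr mulr1 in h1.
  by rewrite mulrC in h2; lra.
Qed.

Lemma bounded_below_sub H K (f : H -> K) V W :
  V `<=` W -> bounded_below f W -> bounded_below f V.
Proof. by move=> VW [c c0 h]; exists c => // x /VW/h. Qed.

Lemma hdim_image H K (f : H -> K) V :
  blin f -> clsub V -> bounded_below f V -> hdim V #= hdim (f @` V).
Proof.
move=> bf cV fV; have cfV := bounded_below_image bf cV fV.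
apply: (hdim_eq_pairing bf) => // [x Vx h|w Ww h].
  by apply: (bounded_below_inj fV) => //; apply/ip_eq0/h; exists x.
by have [x Vx xw] := Ww; apply: ip_eq0; rewrite -{1}xw; exact: h.
Qed.

Lemma hdim_image_ominus H K (f : H -> K) (L M : set H) :
  blin f -> clsub L -> clsub M -> M `<=` L -> bounded_below f L ->
  hdim (ominus L M) #= hdim (ominus (f @` L) (f @` M)).
Proof.
move=> bf cL cM ML fL; have fM := bounded_below_sub ML fL.
have cfL := bounded_below_image bf cL fL.
have cfM := bounded_below_image bf cM fM.
have fML : f @` M `<=` f @` L by move=> _ [x /ML Lx <-]; exists x.
apply: (hdim_eq_pairing bf); [exact: clsub_ominus|exact: clsub_ominus| |].
- move=> x [Lx xM] h.
  have [y My fy] : (f @` M) (f x) by apply: (ominusK cfM cfL fML) => //; exists x.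
  suff xy : x = y by apply/ip_eq0/xM; rewrite xy.
  apply/subr0_eq/(bounded_below_inj fL); first by apply: clsubB => //; exact: ML.
  by rewrite blinB // fy subrr.
- move=> w [[x Lx xw] wM] h; apply: ip_eq0; rewrite -{1}xw.
  have -> : f x = f (proj M x) + f (x - proj M x) by rewrite -blinD // addrC subrK.
  rewrite ipDl (h (x - proj M x)) ?addr0; first by apply/ip_eq0C/wM; exists (proj M x) => //; exact: proj_in.
  split; last by have [] := proj_orth x cM.
  by apply: clsubB => //; apply: ML; exact: proj_in.
Qed.

End BoundedBelow.

(** * Spectral decomposition at a given level *)

Section ConvexSequence.
Context {R : realType}.
Variable b : nat -> R.
Hypothesis b_convex : forall k, 2 * b k.+1 <= b k + b k.+2.

Lemma convex_seq_rise k n : b k <= b k.+1 -> b k <= b (k + n)%N.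
Proof.
move=> bk; suff: b k <= b (k + n)%N /\ b (k + n)%N <= b (k + n).+1 by case.
elim: n => [|n [ih1 ih2]]; first by rewrite addn0.
by rewrite addnS; have := b_convex (k + n); lra.
Qed.

Lemma convex_seq_dichotomy i n : b (i + n)%N <= b i \/ b (i + n)%N <= b (i + n).+1.
Proof.
elim: n => [|n ih]; first by left; rewrite addn0.
rewrite addnS; have := b_convex (i + n).
have [h|h] := leP (b (i + n).+1) (b i); first by left.
by right; case: ih; lra.
Qed.

Lemma convex_seq_le_ends i j k : (forall m, 0 <= b m) ->
  (i <= j)%N -> (j <= k)%N -> b j <= b i + b k.
Proof.
move=> b0 ij jk; rewrite -(subnKC ij).
have [h|h] := convex_seq_dichotomy i (j - i).
  by apply: le_trans h _; rewrite lerDl.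
rewrite (subnKC ij) in h *; have := convex_seq_rise (k - j) h.
by rewrite subnKC //; have := b0 i; lra.
Qed.

Lemma convex_seq_bounded c : (forall k, b k <= c) -> forall k, b k <= b 0%N.
Proof.
move=> bc; suff dec k : b k.+1 <= b k.
  by elim=> // k; apply: le_trans; exact: dec.
rewrite leNgt; apply/negP => h.
have grow n : b k.+1 + n%:R * (b k.+1 - b k) <= b (k.+1 + n)%N /\
    b k.+1 - b k <= b (k.+1 + n).+1 - b (k.+1 + n)%N.
  elim: n => [|n [ih1 ih2]].
    by rewrite mul0r addr0 addn0; have := b_convex k; lra.
  by rewrite addnS -natr1 mulrDl mul1r; have := b_convex (k.+1 + n); lra.
have d0 : 0 < b k.+1 - b k by rewrite subr_gt0.
have [g _] := grow (Num.truncn ((c - b k.+1) / (b k.+1 - b k))).+1.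
have := bc (k.+1 + (Num.truncn ((c - b k.+1) / (b k.+1 - b k))).+1)%N.
have := truncnS_gt ((c - b k.+1) / (b k.+1 - b k)).
by rewrite ltr_pdivrMr //; lra.
Qed.

End ConvexSequence.

Section SpectralSplit.
Context {R : realType}.
Implicit Types (H K : hilbertType R).

(** The operator [z |-> z + S z] is bounded below, so that its range is closed.
    A vector [w] orthogonal to the range is orthogonal to its own image
    [w + S w], which forces [w = 0]. *)
Lemma lax_milgram H (S : H -> H) : blin S -> (forall z, 0 <= reip (S z) z) ->
  forall x, exists z, z + S z = x.
Proof.
move=> bS S0 x; pose B z := z + S z.
have bB : blin B by apply: blin_add => //; exact: blin_id.
have B1 z : reip (B z) z = nrm z ^+ 2 + reip (S z) z by rewrite reipDl nrm_sq.
have cB : clsub (B @` [set: H]).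
  apply: bounded_below_image => //; exists 1 => // z _; rewrite mul1r.
  have [->|/nrm_gt0 z0] := pselect (z = 0); first by rewrite nrm0 nrm_ge0.
  rewrite -(ler_pM2r z0) -expr2; apply: le_trans (reip_le _ _).
  by rewrite B1 lerDl.
have [_ po] := proj_orth x cB.
have [z _ Bz] := proj_in x cB; exists z; rewrite -/(B z) Bz.
apply/esym/subr0_eq; set w := x - _.
have : reip (B w) w = 0.
  by rewrite reipC /reip (po (B w)) //; exists w.
rewrite B1 => h; apply: nrm_eq0; apply/eqP; rewrite -sqrf_eq0; apply/eqP/le_anti.
by rewrite sqr_ge0 andbT; have := S0 w; lra.
Qed.

Section Powers.
Context {H K : hilbertType R}.
Variable A : H -> K.
Hypothesis bA : blin A.

Let T : H -> H := adj A \o A.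

Let bT : blin T.
Proof. by apply: blin_comp => //; exact: adj_blin. Qed.

Let bTn n : blin (iter n T).
Proof. by elim: n => [|n ih]; [exact: blin_id|exact: blin_comp bT ih]. Qed.

Let T_ip x y : inner (T x) y = inner (A x) (A y).
Proof. by rewrite /T /= adjP'. Qed.

Let T_ipr x y : inner x (T y) = inner (A x) (A y).
Proof. by rewrite /T /= -adjP. Qed.

Let Tn_ip i j x y : inner (iter i T x) (iter j T y) = inner (iter (i + j) T x) y.
Proof.
elim: j i => [|j ih] i; first by rewrite addn0.
by rewrite addnS -addSn -ih /= T_ip T_ipr.
Qed.

Let b k z := reip (iter k T z) z.

Let b_even j z : b (j + j) z = nrm (iter j T z) ^+ 2.
Proof. by rewrite nrm_sq /b /reip -Tn_ip. Qed.

Let b_ge0 k z : 0 <= b k z.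
Proof.
rewrite -(odd_double_half k) -addnn; case: (odd k) => /=; last first.
  by rewrite add0n b_even sqr_ge0.
by rewrite add1n -addSn /b /reip -Tn_ip /= T_ip -/(reip _ _) -nrm_sq sqr_ge0.
Qed.

Let b_convex z k : 2 * b k.+1 z <= b k z + b k.+2 z.
Proof.
have := b_ge0 k (z - T z); rewrite /b blinB // -iterSr !reipE.
have e1 : reip (iter k T z) (T z) = b k.+1 z.
  by rewrite /b /reip (Tn_ip k 1) addn1.
have e2 : reip (iter k.+1 T z) (T z) = b k.+2 z.
  by rewrite /b /reip (Tn_ip k.+1 1) addn1.
by rewrite e1 e2 /b; lra.
Qed.

Let N : set H := [set x | exists c, forall j, nrm (iter j T x) <= c].

Let N_le x : N x -> forall j, nrm (iter j T x) <= nrm x /\ b j x <= b 0 x.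
Proof.
move=> [c xc].
have ev j : b (j + j) x <= c ^+ 2.
  by rewrite b_even lerXn2r ?nnegrE ?nrm_ge0 // (le_trans (nrm_ge0 _) (xc j)).
have bc k : b k x <= c ^+ 2.
  rewrite -(odd_double_half k) -addnn; set j := k./2.
  case: (odd k) => /=; last by rewrite add0n.
  have := b_convex x (j + j); have := ev j; have := ev j.+1.
  by rewrite addnS addSn add1n; lra.
have bb := convex_seq_bounded (b_convex x) bc.
move=> j; split=> //.
by have := bb (j + j)%N; rewrite b_even /b /= -nrm_sq ler_pXn2r ?nnegrE ?nrm_ge0.
Qed.

Let cN : clsub N.
Proof.
split=> [|a x y [c xc] [d yd]|x h].
- by exists 0 => j; rewrite blin0 // nrm0.
- exists (cabs a * c + d) => j; rewrite (bTn j).1.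
  apply: le_trans (nrmD _ _) _; rewrite nrmZ lerD //.
  by rewrite ler_wpM2l ?cabs_ge0.
- exists (nrm x) => j; have [M M0 TM] := (bTn j).2.
  apply/ler_addgt0Pr => e e0.
  have M2 : 0 < M + 2 by lra.
  have [y /N_le/(_ j)[yj _] xy] := h _ (divr_gt0 e0 M2).
  have := nrm_triangle (iter j T x) (iter j T y) 0.
  have := TM (x - y); rewrite blinB // !subr0 => h1.
  have := nrm_triangle x y 0; have := nrm_triangle y x 0.
  move: xy; rewrite ltr_pdivlMr // !subr0 (nrmBC y x) mulrDr => xy h2 h3.
  have := nrm_triangle (iter j T y) (iter j T x) 0.
  have := nrm_triangle (iter j T x) (iter j T y) 0; rewrite !subr0 => h4 h5.
  by have := nrm_ge0 (x - y); lra.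
Qed.

(** Take for [M] the orthogonal complement of the set [N] of the vectors whose
    iterates under [T] remain bounded. For [x] in [N], the convex sequence
    [<T^k x, x>] is bounded, hence decreasing, and its first two terms are
    [|x|^2] and [|A x|^2]. If some [x] in [M] had [|A x| < |x|], the solutions
    [z] of [z + T^n z = x] would satisfy [|T^j z| <= |x|] for [j <= n] while
    [<x, z>] stays away from 0. These conditions define nested convex sets,
    any common point of which lies in [N] without being orthogonal to [x]. *)
Lemma spectral_split1 : exists M, [/\ clsub M,
  forall x, M x -> nrm x <= nrm (A x) &
  forall x, orthc M x -> nrm (A x) <= nrm x].
Proof.
have b1 z : b 1 z = nrm (A z) ^+ 2 by rewrite nrm_sq /b /reip /= T_ip.
exists (orthc N); split; first exact: clsub_orthc; last first.
  move=> x /(orthcK cN)/N_le/(_ 1%N)[_].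
  by rewrite b1 /b /= -nrm_sq ler_pXn2r ?nnegrE ?nrm_ge0.
move=> x [_ xN]; rewrite leNgt; apply/negP => Axx.
pose eta := nrm x ^+ 2 - nrm (A x) ^+ 2.
have eta0 : 0 < eta by rewrite subr_gt0 ltr_pXn2r ?nnegrE ?nrm_ge0.
pose D k : set H :=
  [set z | (forall j, (j <= k)%N -> nrm (iter j T z) <= nrm x) /\ eta <= reip x z].
have [|||||p pD] := @nested_convex R H D (nrm x).
- move=> k; have [z zx] := lax_milgram (bTn k.+1) (b_ge0 k.+1) x.
  exists z; split=> [j jk|].
    rewrite -(@ler_pXn2r _ 2) ?nnegrE ?nrm_ge0 // -b_even.
    have jk2 : (j + j <= k.+1 + k.+1)%N by rewrite leq_add // ltnW.
    apply: le_trans (convex_seq_le_ends (b_convex z) (b_ge0^~ z) (leq0n _) jk2) _.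
    rewrite b_even -zx [leRHS]nrm_sq !reipE -!nrm_sq /b /= -nrm_sq.
    rewrite (reipC (T _)); have := b_ge0 k.+1 z; rewrite /b /=.
    by lra.
  (* It remains to see that [<x, T^n z> <= <T x, x> = |A x|^2], which follows
     from the convexity of [<T^k z, z>] once [x] is replaced by [z + T^n z]. *)
  have -> : z = x - iter k.+1 T z by rewrite -zx addrK.
  rewrite !reipE -nrm_sq /eta lerD2l lerN2 -b1.
  have e1 : reip x (iter k.+1 T z) = b k.+1 z + b (k.+1 + k.+1)%N z.
    by rewrite -zx reipDl -nrm_sq -b_even /b reipC.
  have e2 : b 1 x = b 1 z + 2 * b k.+2 z + b (k.+2 + k.+1)%N z.
    rewrite -{1}zx /b blinD ?blin_id // !reipE.
    have -> : iter 1 T (iter k.+1 T z) = iter k.+2 T z by [].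
    have -> : reip (iter 1 T z) (iter k.+1 T z) = reip (iter k.+2 T z) z.
      by rewrite /reip Tn_ip add1n.
    have -> : reip (iter k.+2 T z) (iter k.+1 T z) = reip (iter (k.+2 + k.+1) T z) z.
      by rewrite /reip Tn_ip.
    by lra.
  rewrite e1 e2.
  have := @convex_seq_le_ends _ _ (b_convex z) 1 k.+1 k.+2 (b_ge0^~ z) isT (leqnSn _).
  have := @convex_seq_le_ends _ _ (b_convex z) k.+2 (k.+1 + k.+1) (k.+2 + k.+1) (b_ge0^~ z).
  rewrite addSn ltnS leq_addl => /(_ isT (leqnSn _)).
  by rewrite -addSn; lra.
- by move=> k z [zj ez]; split=> // j jk; apply: zj; exact: leqW.
- by move=> k z [/(_ 0%N (leq0n _))].
- move=> k y z [yj ey] [zj ez]; split=> [j jk|]; last by rewrite !reipE; lra.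
  rewrite blinZ // nrmZr ?invr_ge0 // blinD //.
  by have := nrmD (iter j T y) (iter j T z); have := yj _ jk; have := zj _ jk; lra.
- move=> k z h; split=> [j jk|].
    apply/ler_addgt0Pr => e e0; have [M M0 TM] := (bTn j).2.
    have M1 : 0 < M + 1 by lra.
    have [y [yj _]] := h _ (divr_gt0 e0 M1).
    rewrite ltr_pdivlMr // mulrDr mulr1 => zy.
    have := nrm_triangle (iter j T z) (iter j T y) 0.
    have := nrm_triangle (iter j T y) (iter j T z) 0.
    have := nrm_triangle (iter j T z) (iter j T y) 0.
    rewrite !subr0; have := TM (z - y); rewrite blinB //.
    have := yj _ jk; have := nrm_ge0 (z - y).
    have := nrmD (iter j T z - iter j T y) (iter j T y); rewrite subrK.
    by lra.
  apply/ler_addgt0Pr => e e0.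
  have x1 : 0 < nrm x + 1 by have := nrm_ge0 x; lra.
  have [y [_ ey]] := h _ (divr_gt0 e0 x1).
  rewrite ltr_pdivlMr // mulrDr mulr1 => zy.
  have := reip_le x (y - z); rewrite !reipE (nrmBC y z).
  by have := nrm_ge0 (z - y); lra.
have Np : N p.
  by exists (nrm x) => j; have [pj _] := pD j; exact: pj.
by have [_] := pD 0%N; rewrite /reip xN // leNgt eta0.
Qed.

End Powers.

Lemma spectral_split H K (A : H -> K) (e : R) : blin A -> 0 < e ->
  exists M, [/\ clsub M,
    forall x, M x -> e * nrm x <= nrm (A x) &
    forall x, orthc M x -> nrm (A x) <= e * nrm x].
Proof.
move=> bA e0; have ie0 : 0 <= e^-1 by rewrite invr_ge0 ltW.
have [M [cM MA MA']] := spectral_split1 (blin_scale (e^-1)%:C bA).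
exists M; split=> // x /[dup] Mx; [move=> /MA|move=> /MA']; rewrite nrmZr //.
  by rewrite ler_pdivlMl.
by rewrite ler_pdivrMl.
Qed.

(** * Closed subspaces of the range *)

(** If [F] were unbounded, functionals of arbitrarily large norm would yield
    nested closed balls on which they are large, contradicting boundedness at
    a common point. *)
Lemma uniform_boundedness K (F : set K) :
  (forall y, exists C : R, forall k, F k -> cabs (inner y k) <= C) ->
  exists C : R, forall k, F k -> nrm k <= C.
Proof.
move=> bF; apply: contrapT => nF.
have big C : exists2 k, F k & C < nrm k.
  apply: contrapT => h; apply: nF; exists C => k Fk.
  by rewrite leNgt; apply/negP => h'; apply: h; exists k.
have /choice[f fP] : forall nxr : nat * (K * R), exists xr : K * R,
    0 < nxr.2.2 -> [/\ 0 < xr.2,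
      forall y, nrm (y - xr.1) <= xr.2 -> nrm (y - nxr.2.1) <= nxr.2.2 &
      exists2 k, F k & forall y, nrm (y - xr.1) <= xr.2 ->
        nxr.1%:R <= cabs (inner y k)].
  move=> [n [x r]] /=.
  have [r0|nr0] := pselect (0 < r); last by exists (x, r).
  have [k Fk] := big (n%:R * 4 / r); rewrite ltr_pdivrMr // => kn.
  have k0 : 0 < nrm k.
    by rewrite -(pmulr_lgt0 _ r0); apply: le_lt_trans kn; rewrite mulr_ge0.
  have [u nu uk] : exists2 u : K, nrm u = 1 & reip u k = nrm k.
    exists (((nrm k)^-1)%:C *: k).
      by rewrite nrmZr ?invr_ge0 ?nrm_ge0 // mulVf ?gt_eqF.
    by rewrite reipZl -nrm_sq expr2 mulKf // gt_eqF.
  (* Move from [x] by [r / 2] along [k], in the direction [s] that increases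
     the modulus of [reip x k]. *)
  have main (s : R) : `|s| = 1 -> 0 <= s * reip x k -> exists xr : K * R,
    0 < r -> [/\ 0 < xr.2,
      forall y, nrm (y - xr.1) <= xr.2 -> nrm (y - x) <= r &
      exists2 k, F k & forall y, nrm (y - xr.1) <= xr.2 ->
        n%:R <= cabs (inner y k)].
    move=> s1 sx; exists (x + (s * (r / 2))%:C *: u, r / 4) => _ /=.
    have nsu : nrm ((s * (r / 2))%:C *: u) = r / 2.
      rewrite nrmZ nu mulr1 /cabs normc_def /= expr0n /= addr0 sqrtr_sqr.
      by rewrite normrM s1 mul1r ger0_norm // divr_ge0 // ltW.
    split; first by rewrite divr_gt0.
      move=> y yr; have := nrm_triangle (x + (s * (r / 2))%:C *: u) y x.
      have -> : x + (s * (r / 2))%:C *: u - x = (s * (r / 2))%:C *: u.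
        by rewrite addrAC subrr add0r.
      by rewrite nsu; lra.
    exists k => // y yr.
    have := reip_le (s%:C *: (x + (s * (r / 2))%:C *: u - y)) k.
    rewrite nrmZ /cabs normc_def /= expr0n /= addr0 sqrtr_sqr s1 mul1r.
    rewrite reipZl !reipE uk nrmBC => h.
    have ss : s * s = 1 by rewrite -expr2 -real_normK ?num_real // s1 expr1n.
    have h2 : nrm (y - (x + (s * (r / 2))%:C *: u)) * nrm k <= r / 4 * nrm k.
      by rewrite ler_wpM2r ?nrm_ge0.
    have h3 : s * (s * (r / 2) * nrm k) = r / 2 * nrm k.
      by rewrite !mulrA ss mul1r.
    have h4 : n%:R <= s * reip y k.
      by rewrite !mulrDr h3 mulrN in h; lra.
    apply: le_trans h4 _.
    have <- : reip (s%:C *: y) k = s * reip y k by exact: reipZl.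
    apply: le_trans (Re_le_cabs _) _; rewrite ipZl cabsM.
    by rewrite /cabs normc_def /= expr0n /= addr0 sqrtr_sqr s1 mul1r.
  have [h|h] := leP 0 (reip x k).
    by apply: (main 1); rewrite ?normr1 ?mul1r.
  by apply: (main (-1)); rewrite ?normrN1 // mulN1r oppr_ge0 ltW.
pose xr := fix xr n := if n is m.+1 then f (m, xr m) else (0 : K, 1 : R).
have xr0 n : 0 < (xr n).2.
  by elim: n => [|n ih] /=; [exact: ltr01|have [] := fP (n, xr n) ih].
pose D n : set K := [set y | nrm (y - (xr n).1) <= (xr n).2].
have [|||||p pD] := @nested_convex R K D 1.
- by move=> n; exists (xr n).1; rewrite /D /= subrr nrm0 ltW.
- by move=> n y; have [_ h _] := fP (n, xr n) (xr0 n); exact: h.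
- elim=> [|n ih] y; first by rewrite /D /= subr0.
  by move=> yn; apply: ih; have [_ h _] := fP (n, xr n) (xr0 n); exact: h.
- move=> n y z yn zn; rewrite /D /=; set c := (xr n).1.
  have -> : (2^-1)%:C *: (y + z) - c = (2^-1)%:C *: ((y - c) + (z - c)).
    by rewrite addrACA -opprD scalerBr half_double.
  rewrite nrmZr ?invr_ge0 //; have := nrmD (y - c) (z - c).
  by move: yn zn; rewrite /D /= -/c; lra.
- move=> n y h; rewrite /D /=; apply/ler_addgt0Pr => e /h[z zn yz].
  by move: zn; rewrite /D /=; have := nrm_triangle z y (xr n).1; lra.
have [C CP] := bF p.
have [_ _ [k Fk kp]] := fP ((Num.truncn C).+1, xr (Num.truncn C).+1) (xr0 _).
have := kp _ (pD (Num.truncn C).+2); rewrite /= => h.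
by have := CP _ Fk; apply/negP; rewrite -ltNge; apply: lt_le_trans h; exact: truncnS_gt.
Qed.

End SpectralSplit.

Section ClosedRange.
Context {R : realType}.
Implicit Types (H K : hilbertType R).

Definition ker H K (f : H -> K) : set H := [set x | f x = 0].

Lemma clsub_ker H K (f : H -> K) : blin f -> clsub (ker f).
Proof.
move=> bf; have c0 : clsub [set (0 : K)].
  split=> [//|a x y -> ->|x h]; first by rewrite scaler0 addr0.
  apply/nrm_eq0/le_anti; rewrite nrm_ge0 andbT.
  apply/ler_addgt0Pr => e /h[_ ->]; rewrite subr0 add0r.
  exact: ltW.
exact: clsub_preimage bf c0.
Qed.

Lemma clsub_closure_range H K (f : H -> K) : blin f -> clsub (closure (range f)).
Proof.
move=> bf; split=> [|a x y /closureP cx /closureP cy|x h]; apply/closureP.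
- by move=> e e0; exists 0; [exists 0 => //; exact: blin0|rewrite subrr nrm0].
- move=> e e0; have e20 := divr_gt0 e0 (ltr0n R 2).
  have a1 : 0 < cabs a + 1 by rewrite ltr_wpDl ?cabs_ge0.
  have [_ [u _ <-] xu] := cx _ (divr_gt0 e20 a1).
  have [_ [v _ <-] yv] := cy _ e20.
  exists (f (a *: u + v)); first by exists (a *: u + v).
  rewrite bf.1 opprD addrACA -scalerBr; apply: le_lt_trans (nrmD _ _) _.
  rewrite nrmZ; move: xu; rewrite ltr_pdivlMr // mulrDr mulr1.
  by have := nrm_ge0 (x - f u); lra.
- move=> e e0; have e20 := divr_gt0 e0 (ltr0n R 2).
  have [y /closureP cy xy] := h _ e20; have [z rz yz] := cy _ e20.
  by exists z => //; have := nrm_triangle y x z; lra.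
Qed.

Lemma range_closure H K (f : H -> K) x : closure (range f) (f x).
Proof. by apply: subset_closure; exists x. Qed.

Lemma orthc_closure_range H K (f : H -> K) w :
  (forall x, inner w (f x) = 0) -> orthc (closure (range f)) w.
Proof.
move=> wf; split=> // v /closureP cv; apply: cabs_le_eq0 => e e0.
have w1 : 0 < nrm w + 1 by rewrite ltr_wpDl ?nrm_ge0.
have [_ [x _ <-] vx] := cv _ (divr_gt0 e0 w1).
have -> : inner w v = inner w (v - f x) by rewrite ipBr wf subr0.
apply: le_trans (cabs_ip_le _ _) _.
move: vx; rewrite ltr_pdivlMr // mulrDr mulr1 mulrC.
by have := nrm_ge0 (v - f x); lra.
Qed.

(** This is the open mapping theorem for an operator onto a closed subspace
    [V]. With [M] the part of the inverse image of [V] orthogonal to the kernel,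
    uniform boundedness shows that [k |-> proj M (adj A k)] is bounded below
    on [V]. Its image is closed, and dense in [M]: every [x] in [M] is
    [proj M (adj A k)] for some [k] controlled by [x], whence
    [|x|^2 = <A x, k> <= c |A x| |x|]. *)
Lemma closed_subrange H K (A : H -> K) (V : set K) :
  blin A -> clsub V -> V `<=` range A ->
  exists M, [/\ clsub M, bounded_below A M & A @` M = V].
Proof.
move=> bA cV VA; have cN := clsub_ker bA.
pose M := (A @^-1` V) `&` orthc (ker A).
have cM : clsub M by apply: clsubI; [exact: clsub_preimage|exact: clsub_orthc].
have onto v : V v -> exists2 x, M x & A x = v.
  move=> Vv; have [x _ Ax] := VA _ Vv.
  have Ae : A (x - proj (ker A) x) = v.
    have px : A (proj (ker A) x) = 0 := proj_in x cN.
    by rewrite blinB // px subr0.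
  exists (x - proj (ker A) x) => //; split; last exact: proj_orth.
  by rewrite /preimage /= Ae.
have AM : A @` M = V.
  apply/seteqP; split=> [_ [x [Vx _] <-] //|v /onto[x Mx <-]].
  by exists x.
pose S k := proj M (adj A k).
have bS : blin S by apply: blin_comp (proj_blin cM) (adj_blin bA).
have SP x k : M x -> inner x (S k) = inner (A x) k.
  move=> Mx; rewrite adjP //; have [_ po] := proj_orth (adj A k) cM.
  apply/esym/subr0_eq; rewrite -ipBr ip_eq0C //; exact: po.
pose F : set K := [set k | V k /\ nrm (S k) <= 1].
have [C CP] : exists C : R, forall k, F k -> nrm k <= C.
  apply: uniform_boundedness => y.
  have [x Mx Ax] := onto _ (proj_in y cV).
  exists (nrm x) => k [Vk Sk].
  have -> : inner y k = inner x (S k).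
    rewrite SP // Ax; have [_ po] := proj_orth y cV.
    by apply/subr0_eq; rewrite -ipBl; exact: po.
  apply: le_trans (cabs_ip_le _ _) _.
  by rewrite ler_piMr ?nrm_ge0.
have C1 : 0 < `|C| + 1 by rewrite ltr_wpDl.
have Sbelow k : V k -> nrm k <= (`|C| + 1) * nrm (S k).
  move=> Vk; apply/ler_addgt0Pr => e e0.
  pose s := nrm (S k) + e / (`|C| + 1).
  have s0 : 0 < s by rewrite ltr_wpDl ?nrm_ge0 // divr_gt0.
  have /CP : F ((s^-1)%:C *: k).
    split; first exact: clsubZ.
    rewrite blinZ // nrmZr ?invr_ge0 ?(ltW s0) // ler_pdivrMl // mulr1.
    by rewrite /s lerDl divr_ge0 // ltW.
  rewrite nrmZr ?invr_ge0 ?(ltW s0) // ler_pdivrMl // => h.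
  have sE : s * (`|C| + 1) = (`|C| + 1) * nrm (S k) + e.
    by rewrite /s mulrDl divfK ?gt_eqF // mulrC.
  rewrite -sE; apply: le_trans h _.
  by rewrite ler_pM2l //; have := ler_norm C; lra.
have SV : bounded_below S V.
  exists (`|C| + 1)^-1; first by rewrite invr_gt0.
  by move=> k Vk; rewrite ler_pdivrMl //; exact: Sbelow.
have cSV := bounded_below_image bS cV SV.
exists M; split=> //; exists (`|C| + 1)^-1; first by rewrite invr_gt0.
move=> x Mx; rewrite ler_pdivrMl //.
have [k Vk Sk] : (S @` V) x.
  apply: (ominusK cSV cM) => // [_ [k _ <-]|w [Mw wS]]; first exact: proj_in.
  suff -> : w = 0 by rewrite ip0r.
  have Aw0 : A w = 0.
    apply: ip_eq0; rewrite -SP //; apply: wS; exists (A w) => //.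
    by case: Mw.
  by apply: (@orthc_self _ _ (ker A)) => //; case: Mw.
have [->|/nrm_gt0 x0] := pselect (x = 0).
  by rewrite nrm0 mulr_ge0 ?nrm_ge0 // ltW.
rewrite -(ler_pM2r x0) -expr2 nrm_sq.
have -> : reip x x = reip (A x) k by rewrite /reip -SP // Sk.
apply: le_trans (reip_le _ _) _.
rewrite mulrAC [leRHS]mulrC ler_wpM2l ?nrm_ge0 //.
by have := Sbelow _ Vk; rewrite Sk.
Qed.

Lemma ominus_ominus H (L M : set H) : clsub L -> clsub M -> M `<=` L ->
  ominus (orthc M) (ominus L M) = orthc L.
Proof.
move=> cL cM ML; apply/seteqP; split=> x; last first.
  move=> [_ xL]; split; first by split=> // v /ML; exact: xL.
  by move=> v [Lv _]; exact: xL.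
move=> [[_ xM] xLM]; split=> // v Lv.
rewrite -[v](subrK (proj M v)) ipDr (xM (proj M v)) ?addr0; last exact: proj_in.
apply: xLM; split; last by have [] := proj_orth v cM.
by apply: clsubB => //; apply: ML; exact: proj_in.
Qed.

Lemma hdim_orthc_orthc H (L M : set H) : clsub L -> clsub M -> M `<=` L ->
  hdim (orthc M) #= hdim (ominus L M) #+ hdim (orthc L).
Proof.
move=> cL cM ML; rewrite -(ominus_ominus cL cM ML).
apply: hdim_ominus; [exact: clsub_orthc|exact: clsub_ominus|].
by move=> x [_].
Qed.

(** Modulo the kernel, [A] identifies the complement of [M + ker A] with a
    dense subspace of the complement of [A @` M] in the closure of the range. *)
Lemma codim_source H K (A : H -> K) (M : set H) :
  blin A -> clsub M -> bounded_below A M ->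
  hdim (orthc M) #= hdim (ker A) #+ hdim (ominus (closure (range A)) (A @` M)).
Proof.
move=> bA cM bM; have cN := clsub_ker bA.
have cV := bounded_below_image bA cM bM.
have cC := clsub_closure_range bA.
pose L := A @^-1` (A @` M).
have cL : clsub L by exact: clsub_preimage.
have ML : M `<=` L by move=> x Mx; exists x.
apply: card_eq_trans (hdim_orthc_orthc cL cM ML) _; apply: card_add_eq2.
  apply: (hdim_eq_pairing (@blin_id R H)) => //; first exact: clsub_ominus.
  - move=> x [[y My Ayx] xM] h; apply: ip_eq0.
    rewrite -{2}[x](subrK y) ipDr (xM y) // addr0; apply: h.
    by rewrite /ker /= blinB // Ayx subrr.
  - move=> n An h; apply: (bounded_below_inj bM) => //.
    apply: (ominusK cM cL ML) => [|w /h]; last exact: ip_eq0C.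
    by exists 0; [case: cM|rewrite An; exact: blin0].
have VC : A @` M `<=` closure (range A) by move=> _ [x _ <-]; exact: range_closure.
apply: (hdim_eq_pairing bA); [exact: clsub_orthc|exact: clsub_ominus| |].
- move=> x xL h; apply: (@orthc_self _ _ L) => //.
  by apply: (ominusK cV cC VC) => //; exact: range_closure.
- move=> w [Cw wV] h; apply: (@orthc_self _ _ (closure (range A))) => //.
  have wR x : inner (A x) w = 0.
    rewrite -[x](subrK (proj L x)) blinD // ipDl (h (x - proj L x)) ?add0r; last exact: proj_orth.
    by have [y My <-] := proj_in x cL; apply/ip_eq0C/wV; exists y.
  by apply: orthc_closure_range => x; exact: ip_eq0C.
Qed.

Lemma codim_target H K (A : H -> K) (M : set H) :
  blin A -> clsub M -> bounded_below A M ->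
  hdim (orthc (A @` M)) #=
    hdim (orthc (closure (range A))) #+ hdim (ominus (closure (range A)) (A @` M)).
Proof.
move=> bA cM bM; apply: card_eq_trans (card_addC _ _).
apply: hdim_orthc_orthc; [exact: clsub_closure_range|exact: bounded_below_image|].
by move=> _ [x _ <-]; exact: range_closure.
Qed.

(** For an infinite bound, bases of the approximating subspaces for all
    [e = 1 / (n + 1)] detect every vector of the closed range. For a finite
    bound [n], vectors of an approximating subspace that are close enough to
    [n + 1] orthonormal vectors are still independent. *)
Lemma hdim_range_approx H K (C : H -> K) (T : Type) (Y : set T) : blin C ->
  (forall e : R, 0 < e -> exists W, [/\ clsub W, hdim W #<= Y &
     forall x, exists2 w, W w & nrm (C x - w) <= e * nrm x]) ->
  hdim (closure (range C)) #<= Y.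
Proof.
move=> bC ap; have cC := clsub_closure_range bC.
have bX := onb_exists (closure (range C)); have [XC oX _] := bX.
set X := hdim _ in bX XC oX *.
have [fY|iY] := pselect (finite_set Y); last first.
  have inv0 (n : nat) : 0 < n.+1%:R^-1 :> R by rewrite invr_gt0 ltr0n.
  have /choice[W WP] : forall n : nat, exists W, [/\ clsub W, hdim W #<= Y &
     forall x, exists2 w, W w & nrm (C x - w) <= n.+1%:R^-1 * nrm x].
    by move=> n; exact: ap.
  pose Z : set (K * nat) := [set yn | hdim (W yn.2) yn.1].
  apply: (@card_le_trans _ _ _ Z).
    apply: (@card_le_matrix R[i] _ _ X Z (fun x yn => inner x yn.1)).
      by move=> [y n] _; exact: countable_support.
    move=> n e c einj eX h i; set z := \sum_i c i *: e i.
    rewrite -(orthonormal_indep c oX einj eX i) -/z.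
    suff -> : z = 0 by rewrite ip0l.
    have Cz : closure (range C) z.
      rewrite /z; elim/big_rec: _ => [|j u _ Vu]; first by case: cC.
      by have [_ VD _] := cC; apply: VD => //; apply: XC.
    have zW k w : W k w -> inner z w = 0.
      have [cW _ _] := WP k; apply: (onb_orth cW (onb_exists _)) => y Yy.
      by rewrite /z nrm_suml; exact: (h (y, k)).
    have zR x : inner z (C x) = 0.
      apply: cabs_le_eq0 => d d0.
      pose q := nrm z * nrm x; have q0 : 0 <= q by rewrite mulr_ge0 ?nrm_ge0.
      pose k := Num.truncn (q / d).
      have [_ _ /(_ x)[w Ww xw]] := WP k.
      have -> : inner z (C x) = inner z (C x - w) by rewrite ipBr (zW _ _ Ww) subr0.
      apply: le_trans (cabs_ip_le _ _) _.
      apply: le_trans (ler_wpM2l (nrm_ge0 z) xw) _.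
      rewrite mulrCA -/q ler_pdivrMl ?ltr0n //.
      by have := truncnS_gt (q / d); rewrite ltr_pdivrMr // => /ltW.
    apply: (@orthc_self _ _ (closure (range C))) => //.
    exact: orthc_closure_range.
  apply: card_le_trans (card_infinite_mul_nat iY).
  have /choice[r rP] : forall n, exists r : K -> T -> Prop,
      (forall x, hdim (W n) x -> exists2 y, Y y & r x y) /\
      (forall x x' y, hdim (W n) x -> hdim (W n) x' -> r x y -> r x' y -> x = x').
    by move=> n; have [_ /card_le_relP] := WP n.
  apply/card_le_relP; exists (fun yn tm => yn.2 = tm.2 /\ r yn.2 yn.1 tm.1).
  split=> [[y n] Zy|[y n] [y' n'] [t m] Zy Zy' /= [<- ryt] [e ryt']].
    by have [+ _] := rP n => /(_ _ Zy)[t Yt ryt]; exists (t, n).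
  subst n'; have [_ rinj] := rP n.
  by have /= -> := rinj _ _ _ Zy Zy' ryt ryt'.
have [n Yn] := fY; apply: contrapT => nXY.
have : ~ (X #<= `I_n) by rewrite -(card_le_eqr Yn).
move=> /card_ge_II/card_le_relP[r [r1 r2]].
have /choice[g gP] : forall i : 'I_n.+1, exists x, X x /\ r i x.
  by move=> i; have [x] := r1 i (ltn_ord i); exists x.
have ginj : injective g.
  move=> i j e; apply: val_inj => /=.
  have [_ ri] := gP i; have [_ rj] := gP j.
  by apply: (r2 i j (g i)); rewrite ?e //=; rewrite -?e //; exact: ltn_ord.
pose eta : R := n.+2%:R^-1.
have eta0 : 0 < eta by rewrite invr_gt0 ltr0n.
have eta20 := divr_gt0 eta0 (ltr0n R 2).
have /choice[u uP] : forall i, exists x, nrm (g i - C x) < eta / 2.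
  move=> i; have [/XC/closureP/(_ _ eta20)[_ [x _ <-] gx] _] := gP i.
  by exists x.
pose s := 1 + \sum_i nrm (u i).
have us i : nrm (u i) <= s.
  rewrite /s (bigD1 i) //= addrCA lerDl addr_ge0 // sumr_ge0 // => j _.
  exact: nrm_ge0.
have s0 : 0 < s by rewrite ltr_wpDr // sumr_ge0 // => j _; exact: nrm_ge0.
have [W [cW WY WP]] := ap _ (divr_gt0 eta20 s0).
have /choice[w wP] : forall i, exists w, W w /\ nrm (g i - w) <= eta.
  move=> i; have [w Ww uw] := WP (u i); exists w; split=> //.
  apply: le_trans (nrm_triangle (C (u i)) _ _) _.
  have := uP i; have : eta / 2 / s * nrm (u i) <= eta / 2.
    by rewrite mulrAC ler_pdivrMr // ler_pM2l.
  by lra.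
have : [set: 'I_n.+1] #<= hdim W.
  apply: (@card_le_matrix R[i] _ _ _ _ (fun i y => inner (w i) y)).
    by move=> y _; apply: finite_set_countable; exact: finite_finset.
  move=> m e c einj _ h.
  have wz : \sum_i c i *: w (e i) = 0.
    apply: (onb_eq0 cW (onb_exists W)) => [|y Yy].
      elim/big_rec: _ => [|j v _ Wv]; first by case: cW.
      by have [_ VD _] := cW; apply: VD => //; have [] := wP (e j).
    by rewrite nrm_suml h.
  have [m0|m0] := posnP m; first by move=> i; exfalso; move: (ltn_ord i); rewrite [X in (_ < X)%N]m0.
  (* In a vanishing combination of the [w (e i)], the largest coefficient is at
     most [m * eta < 1] times itself. *)
  pose i0 := [arg max_(i > Ordinal m0) cabs (c i)]%O.
  have i0P i : cabs (c i) <= cabs (c i0).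
    by rewrite /i0; case: arg_maxP => // j _ /(_ i isT).
  have ci0 : cabs (c i0) <= m%:R * (cabs (c i0) * eta).
    have ge_inj : injective (g \o e) by move=> i j /ginj/einj.
    rewrite -{1}(orthonormal_indep c oX ge_inj (fun i => (gP (e i)).1) i0).
    have -> : \sum_j c j *: (g \o e) j = \sum_j c j *: (g (e j) - w (e j)).
      by under [RHS]eq_bigr do rewrite scalerBr; rewrite sumrB wz subr0.
    apply: le_trans (cabs_ip_le _ _) _.
    rewrite (orthonormal_nrm oX (gP (e i0)).1) mulr1.
    apply: (@le_trans _ _ (\sum_(j < m) cabs (c j) * nrm (g (e j) - w (e j)))).
      elim/big_rec2: _ => [|j x y _ xy]; first by rewrite nrm0.
      by apply: le_trans (nrmD _ _) _; rewrite nrmZ lerD2l.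
    have -> : m%:R * (cabs (c i0) * eta) = \sum_(j < m) cabs (c i0) * eta.
      by rewrite sumr_const card_ord mulr_natl.
    apply: ler_sum => j _.
    by rewrite ler_pM ?cabs_ge0 ?nrm_ge0 //; have [] := wP (e j).
  have meta : m%:R * eta < 1.
    rewrite ltr_pdivrMr ?ltr0n // mul1r ltr_nat ltnS.
    by have := leq_card e einj; rewrite !card_ord.
  have c0 : cabs (c i0) = 0.
    apply: le_anti; rewrite cabs_ge0 andbT leNgt; apply/negP => c0.
    move: ci0; rewrite mulrCA ler_pMr //; apply/negP; rewrite -ltNge.
    by rewrite (le_lt_trans _ meta).
  move=> i; apply: cabs_eq0; apply: le_anti; rewrite cabs_ge0 andbT.
  by rewrite -c0.
move=> /card_le_trans/(_ WY); rewrite (card_le_eqr Yn) -(card_le_eql card_II).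
by rewrite card_le_II ltnn.
Qed.

End ClosedRange.

(** * Operators, homeomorphisms and indices *)

Section Interface.
Context {R : realType}.
Implicit Types (H K : hilbertType R).

Lemma clsub_lin H (V : set H) : clsub V -> lin_subspace V.
Proof.
move=> [V0 VD _]; split; first by rewrite inE.
by move=> a x y; rewrite !inE => Vx Vy; exact: VD.
Qed.

Lemma clsub_complete H (V : set H) : clsub V -> complete_subset V.
Proof.
move=> [_ _ Vcl] F PF cF FV.
have /cauchy_cvg/cvg_ex[x Fx] := cF.
exists x => //; apply: Vcl => e e0.
have Fb : F (ball x e%:C) by apply: Fx; apply: nbhsx_ballx; rewrite ltcR.
have [y [Vy]] := filter_ex (filterI FV Fb).
by rewrite -ball_normE /ball_ /= nrmE ltcR; exists y.
Qed.

Lemma complete_clsub H (V : set H) : lin_subspace V -> complete_subset V -> clsub V.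
Proof.
move=> [V0 VD] cV; split=> [|a x y Vx Vy|x h]; first by rewrite inE in V0.
  by have := VD a x y; rewrite !inE; exact.
have [u uV ul] := approx_seq h.
have ux : u @ \oo --> x.
  apply/cvgrPdist_lt => e /gt0_complexP[/ul[N NP] ->].
  by exists N => // n /= Nn; rewrite nrmE ltcR; exact: NP.
have [||y Vy uy] := cV (u @ \oo).
- by apply: cvg_cauchy; apply/cvg_ex; exists x.
- by exists 0%N => // n _; exact: uV.
by rewrite (cvg_unique _ ux uy).
Qed.

Lemma bop_blin H K (A : 'B(H, K)) : blin A.
Proof.
split=> [a x y|]; first by rewrite linearP.
have [M AM] := bop_bounded A; exists `|M| => // x.
have := AM x; rewrite !nrmE -rmorphM lecR => h; apply: le_trans h _.
by rewrite ler_wpM2r ?nrm_ge0 // ler_norm.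
Qed.

Lemma blin_bop H K (f : H -> K) : blin f -> exists B : 'B(H, K), B = f :> (H -> K).
Proof.
move=> [fl [M _ fM]].
pose g : {linear H -> K} := HB.pack f (GRing.isLinear.Build _ _ _ _ _ fl).
have gM : exists M : R, forall x, `|g x| <= M%:C * `|x|.
  by exists M => x; rewrite !nrmE -rmorphM lecR; exact: fM.
by exists (BoundedOp gM).
Qed.

Lemma blin_continuous H K (f : H -> K) : blin f -> continuous f.
Proof.
move=> bf x; have [fl [M M0 fM]] := bf.
apply/cvgrPdist_lt => e /gt0_complexP[e0 ->].
have M1 : 0 < M + 1 by lra.
apply/nbhs_ballP; exists (complex.Re e / (M + 1))%:C => /=.
  by rewrite ltcR divr_gt0.
move=> y; rewrite -ball_normE /ball_ /= !nrmE !ltcR ltr_pdivlMr // => xy.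
rewrite -blinB //; apply: le_lt_trans (fM _) (le_lt_trans _ xy).
by rewrite mulrC ler_wpM2l ?nrm_ge0 //; lra.
Qed.

Lemma continuous_blin H K (f : H -> K) :
  (forall a x y, f (a *: x + y) = a *: f x + f y) -> continuous f -> blin f.
Proof.
move=> fl fc; split=> //.
have f0 : f 0 = 0 by have := fl (-1) 0 0; rewrite scaler0 addr0 scaleN1r addNr.
have fZ a x : f (a *: x) = a *: f x by rewrite -[a *: x]addr0 fl f0 addr0.
have /cvgrPdist_lt/(_ 1 ltr01)/nbhs_ballP[e /= /gt0_complexP[]] := fc 0.
set d := complex.Re e => d0 -> fd.
exists (2 / d) => [|x]; first by rewrite divr_ge0 // ltW.
have [->|/nrm_gt0 x0] := pselect (x = 0); first by rewrite f0 !nrm0 mulr0.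
have s0 : 0 < d / (2 * nrm x) by rewrite divr_gt0 // mulr_gt0.
have fd1 y : nrm y < d -> nrm (f y) < 1.
  move=> yd; have := fd y; rewrite -ball_normE /ball_ /= f0 !sub0r !normrN !nrmE.
  by rewrite ltcR -(rmorph1 (real_complex R)) ltcR; exact.
have := fd1 ((d / (2 * nrm x))%:C *: x); rewrite fZ !nrmZr ?(ltW s0) //.
have -> : d / (2 * nrm x) * nrm x = d / 2 by field; rewrite gt_eqF.
have d2 : d / 2 < d by rewrite ltr_pdivrMr // ltr_pMr // ltr1n.
move=> /(_ d2) h; apply: ltW.
have -> : 2 / d * nrm x = (d / (2 * nrm x))^-1.
  by field; rewrite !gt_eqF.
by rewrite -[X in _ < X]mulr1 -ltr_pdivrMl ?invr_gt0 // invrK.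
Qed.

Lemma lh_blin H (G : 'G(H)) : blin G.
Proof. by apply: continuous_blin; [exact: linearP|exact: lh_continuous]. Qed.

Lemma lh_inv_blin H (G : 'G(H)) : blin (lh_inv G).
Proof.
apply: continuous_blin => [a x y|]; last exact: lh_inv_continuous.
apply: (can_inj (lh_funK G)).
by rewrite (lh_blin G).1 !(lh_invK G).
Qed.

(** The orthogonal projection onto the image makes the inverse of the
    restriction of [f] to [M] total, hence composable with other operators. *)
Lemma bounded_below_inverse H K (f : H -> K) (M : set H) :
  blin f -> clsub M -> bounded_below f M ->
  exists S : K -> H, [/\ blin S, forall y, M (S y),
    forall y, f (S y) = proj (f @` M) y & forall x, M x -> S (f x) = x].
Proof.
move=> bf cM bM; have cV := bounded_below_image bf cM bM.
have /choice[S SP] : forall y, exists x, M x /\ f x = proj (f @` M) y.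
  by move=> y; have [x Mx fx] := proj_in y cV; exists x.
have inj x y : M x -> M y -> f x = f y -> x = y.
  move=> Mx My e; apply/subr0_eq/(bounded_below_inj bM); first exact: clsubB.
  by rewrite blinB // e subrr.
exists S; split=> [|y|y|x Mx].
- have [_ MD _] := cM; have [pl _] := proj_blin cV; split=> [a x y|].
    apply: inj; [exact: (SP _).1|by apply: MD; exact: (SP _).1|].
    by rewrite bf.1 !(SP _).2 pl.
  have [c c0 fc] := bM; exists c^-1; first by rewrite invr_ge0 ltW.
  move=> y; rewrite ler_pdivlMl //; apply: le_trans (fc _ (SP y).1) _.
  by rewrite (SP y).2 proj_nrm.
- exact: (SP y).1.
- exact: (SP y).2.
- apply: inj => //; first exact: (SP _).1.
  by rewrite (SP _).2 proj_id //; exists x.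
Qed.

Lemma bounded_below_homeo H (h : H -> H) :
  blin h -> bounded_below h [set: H] -> h @` [set: H] = [set: H] ->
  exists G : 'G(H), G = h :> (H -> H).
Proof.
move=> bh bb onto.
have [S [bS _ hS Sh]] := bounded_below_inverse bh (clsubT (H := H)) bb.
pose g : {linear H -> H} := HB.pack h (GRing.isLinear.Build _ _ _ _ _ bh.1).
have gK : cancel g S by move=> x; exact: Sh.
have Kg : cancel S g.
  by move=> y; rewrite /= hS onto proj_id //; exact: clsubT.
by exists (LinearHomeo gK Kg (blin_continuous bh) (blin_continuous bS)).
Qed.

Lemma homeo_glue H (V W : set H) (f g : H -> H) :
  clsub V -> clsub W -> blin f -> blin g ->
  bounded_below f V -> f @` V = W ->
  bounded_below g (orthc V) -> g @` (orthc V) = orthc W ->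
  exists G : 'G(H), (forall x, V x -> G x = f x) /\
    (forall x, orthc V x -> G x = g x).
Proof.
move=> cV cW bf bg fV fVW gV gVW.
pose h x := f (proj V x) + g (x - proj V x).
have bh : blin h.
  apply: blin_add; first exact: blin_comp bf (proj_blin cV).
  exact: blin_comp bg (projC_blin cV).
have hV x : V x -> h x = f x.
  by move=> Vx; rewrite /h proj_id // subrr blin0 // addr0.
have hV' x : orthc V x -> h x = g x.
  by move=> Vx; rewrite /h proj0 // subr0 blin0 // add0r.
have [||G GP] := @bounded_below_homeo H h bh; last first.
- by exists G; rewrite GP.
- apply/seteqP; split=> // y _.
  have [x Vx fx] : (f @` V) (proj W y) by rewrite fVW; exact: proj_in.
  have [x' Vx' gx'] : (g @` (orthc V)) (y - proj W y) by rewrite gVW; exact: proj_orth.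
  by exists (x + x') => //; rewrite blinD // hV // hV' // fx gx' addrC subrK.
- have [c c0 fc] := fV; have [d d0 gd] := gV.
  pose m := Num.min c d; have m0 : 0 < m by rewrite lt_min c0 d0.
  exists m => // x _; rewrite -(@ler_pXn2r _ 2) ?nnegrE ?nrm_ge0 //; last first.
    by rewrite mulr_ge0 ?nrm_ge0 // ltW.
  have fx : W (f (proj V x)) by rewrite -fVW; exists (proj V x) => //; exact: proj_in.
  have gx : orthc W (g (x - proj V x)).
    by rewrite -gVW; exists (x - proj V x) => //; exact: proj_orth.
  rewrite /h nrm_pyth; last by apply/ip_eq0C; case: gx => _; apply.
  rewrite exprMn (proj_pyth x cV) mulrDr -!exprMn; apply: lerD.
    rewrite ler_pXn2r ?nnegrE ?nrm_ge0 ?mulr_ge0 ?nrm_ge0 ?(ltW m0) //.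
    apply: le_trans (fc _ (proj_in _ cV)).
    by rewrite ler_wpM2r ?nrm_ge0 // ge_min lexx.
  rewrite ler_pXn2r ?nnegrE ?nrm_ge0 ?mulr_ge0 ?nrm_ge0 ?(ltW m0) //.
  apply: le_trans (gd _ (proj_orth _ cV)).
  by rewrite ler_wpM2r ?nrm_ge0 // ge_min lexx orbT.
Qed.

Lemma opnorm_le H K (f : H -> K) (e : R) : 0 <= e ->
  (forall x, nrm (f x) <= e * nrm x) -> opnorm f <= e.
Proof.
move=> e0 fe; apply: ge_sup.
  by exists (complex.Re `|f 0|); exists 0 => //=; rewrite normr0 ler01.
move=> _ [x /= x1 <-]; apply: le_trans (fe x) _.
rewrite -[leRHS]mulr1 ler_wpM2l //.
by rewrite -lecR -nrmE.
Qed.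

Lemma opnorm_ge H K (f : H -> K) x : blin f -> nrm (f x) <= opnorm f * nrm x.
Proof.
move=> bf; have [fl [M M0 fM]] := bf.
have [->|/nrm_gt0 x0] := pselect (x = 0); first by rewrite blin0 // !nrm0 mulr0.
have [u ux nu] : exists2 u, x = (nrm x)%:C *: u & nrm u = 1.
  exists ((nrm x)^-1%:C *: x).
    by rewrite scalerA -rmorphM mulfV ?gt_eqF // scale1r.
  by rewrite nrmZr ?invr_ge0 ?nrm_ge0 // mulVf ?gt_eqF.
rewrite {1}ux blinZ // nrmZr ?nrm_ge0 // mulrC ler_pM2r //.
apply: ub_le_sup.
  exists M => _ [y /= y1 <-]; apply: le_trans (fM y) _.
  rewrite -[leRHS]mulr1 ler_wpM2l //.
  by rewrite -lecR -nrmE.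
by exists u => //=; rewrite nrmE nu.
Qed.

Lemma IC_optimal H K (A : H -> K) : blin A ->
  (exists V, [/\ clsub V, V `<=` range A &
     IC (range A) = hdim (ominus (closure (range A)) V)]) /\
  (forall V, clsub V -> V `<=` range A ->
     IC (range A) #<= hdim (ominus (closure (range A)) V)).
Proof.
move=> bA; rewrite /IC; set F := [set D | _].
have [|[V [lV VA cV VE]] Fmin] := @card_minP _ F.
  exists (hdim (ominus (closure (range A)) (ker (@id K)))), (ker (@id K)).
  have ck := clsub_ker (@blin_id R K).
  split; [exact: clsub_lin|by move=> _ ->; exists 0 => //; exact: blin0| |by []].
  exact: clsub_complete.
split=> [|W cW WA].
  by exists V; split=> //; exact: complete_clsub.
apply: Fmin; exists W; split=> //; [exact: clsub_lin|exact: clsub_complete].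
Qed.

Lemma binary_index1P H K (A : H -> K) : blin A ->
  binary_index (range A) = 1%N <->
  exists V, [/\ clsub V, V `<=` range A & hdim V #= hdim (closure (range A))].
Proof.
move=> bA; have cC := clsub_closure_range bA; split.
  move=> h; have /asboolP[W [lW WA [U [[UW Uinj Usurj] Ul Uip]]]] :
      `[< exists W, [/\ lin_subspace W, W `<=` range A &
            isomorphic (closure (range A)) W] >].
    by move: h; rewrite /binary_index; case: asboolP.
  pose f x := U (proj (closure (range A)) x).
  have fU x : closure (range A) x -> f x = U x by move=> Cx; rewrite /f proj_id.
  have Un x : closure (range A) x -> nrm (U x) = nrm x.
    by move=> Cx; apply: nrm_ip_eq; rewrite Uip.
  have bf : blin f.
    have [pl _] := proj_blin cC; split=> [a x y|].
      by rewrite /f pl Ul //; exact: proj_in.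
    by exists 1 => // x; rewrite mul1r Un ?proj_nrm //; exact: proj_in.
  have bb : bounded_below f (closure (range A)).
    by exists 1 => // x Cx; rewrite mul1r fU // Un.
  have fW : f @` closure (range A) = W.
    apply/seteqP; split=> [_ [x Cx <-]|w /Usurj[x Cx <-]].
      by rewrite fU //; exact: UW.
    by exists x => //; exact: fU.
  exists W; split=> //; rewrite -fW; first exact: bounded_below_image.
  by rewrite card_eq_sym; exact: hdim_image.
move=> [V [cV VA VC]].
have [|U [bU UV Uonto Uip]] := hdim_unitary cC cV; first by rewrite card_eq_sym.
rewrite /binary_index; suff -> : `[< exists W, [/\ lin_subspace W,
    W `<=` range A & isomorphic (closure (range A)) W] >] by [].
apply/asboolP; exists V; split=> //; first exact: clsub_lin.
exists U; split=> [|a x y _ _|//]; last exact: bU.1.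
split=> [x /UV //|x y /set_mem Cx /set_mem Cy e|w /Uonto[x Cx <-]]; last by exists x.
apply/subr0_eq/ip_eq0; rewrite -Uip; try exact: (clsubB cC Cx Cy).
by rewrite blinB // e subrr ip0l.
Qed.

End Interface.

(** * Closures of orbits *)

Section Orbits.
Context {R : realType}.
Implicit Types (H K : hilbertType R).

Lemma inverse_bounded_below H K (g : H -> K) (g' : K -> H) :
  blin g' -> cancel g g' -> bounded_below g [set: H].
Proof.
move=> [_ [M M0 gM]] gK; have M1 : 0 < M + 1 by lra.
exists (M + 1)^-1; first by rewrite invr_gt0.
move=> x _; rewrite ler_pdivrMl // -{1}(gK x); apply: le_trans (gM _) _.
by rewrite ler_wpM2r ?nrm_ge0 //; lra.
Qed.

Lemma hdim_orthc_iso H (g g' : H -> H) (M : set H) :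
  blin g -> blin g' -> cancel g g' -> cancel g' g -> clsub M ->
  hdim (orthc M) #= hdim (orthc (g @` M)).
Proof.
move=> bg bg' gK Kg cM; have cT := clsubT (H := H).
have := hdim_image_ominus bg cT cM (@subsetT _ M) (inverse_bounded_below bg' gK).
suff -> : g @` [set: H] = [set: H] by [].
by apply/seteqP; split=> // y _; exists (g' y).
Qed.

(** A vector orthogonal to one of two uniformly close subspaces cannot lie in
    the other one. *)
Lemma close_codim H K (f g : H -> K) (M : set H) (c : R) :
  blin f -> blin g -> clsub M -> 0 < c ->
  (forall x, M x -> c * nrm x <= nrm (f x)) ->
  (forall x, M x -> c * nrm x <= nrm (g x)) ->
  (forall x, M x -> nrm (f x - g x) <= c / 2 * nrm x) ->
  hdim (orthc (f @` M)) #= hdim (orthc (g @` M)).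
Proof.
move=> bf bg cM c0 fM gM fg.
have cf : clsub (f @` M) by apply: bounded_below_image => //; exists c.
have cg : clsub (g @` M) by apply: bounded_below_image => //; exists c.
have key (u v : H -> K) x m : orthc (u @` M) x -> M m -> x = v m ->
    c * nrm m <= nrm (v m) -> nrm (u m - v m) <= c / 2 * nrm m -> x = 0.
  move=> [_ xu] Mm xv vm uv; subst x.
  have o : inner (v m) (- u m) = 0.
    by rewrite ipNr xu ?oppr0 //; exists m.
  have : nrm (v m - u m) <= nrm (v m) / 2.
    by rewrite nrmBC; apply: le_trans uv _; lra.
  rewrite -(@ler_pXn2r _ 2) ?nnegrE ?divr_ge0 ?nrm_ge0 // nrm_pyth // nrmN.
  have := sqr_ge0 (nrm (u m)); rewrite expr_div_n => h1 h2.
  apply: nrm_eq0; apply/eqP; rewrite -sqrf_eq0; apply/eqP/le_anti.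
  rewrite sqr_ge0 andbT.
  have : nrm (v m) ^+ 2 <= nrm (v m) ^+ 2 / 2 ^+ 2 by lra.
  by move: (nrm (v m) ^+ 2) => q; lra.
apply: (hdim_eq_pairing (@blin_id R K)); try exact: clsub_orthc.
- move=> x xf h; have [m Mm mx] : (g @` M) x.
    by apply: orthcK => //; split.
  by apply: (key f g x m) => //; [exact: gM|exact: fg].
- move=> x xg h; have [m Mm mx] : (f @` M) x.
    by apply: orthcK => //; split=> // v /h; exact: ip_eq0C.
  by apply: (key g f x m) => //; [exact: fM|rewrite nrmBC; exact: fg].
Qed.

Lemma closure_near H K (A C : 'B(H, K)) :
  norm_closure (GG_orbit A) C <->
  forall e : R, 0 < e -> exists (G1 : 'G(H)) (G2 : 'G(K)),
    forall x, nrm (C x - G2 (A (lh_inv G1 x))) <= e * nrm x.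
Proof.
have bB (T : 'B(H, K)) : blin (fun x => C x - T x).
  have bN : blin (fun x => -1 *: T x) by apply/blin_scale/bop_blin.
  have := blin_add (bop_blin C) bN.
  by under eq_fun do rewrite scaleN1r.
split=> [h e e0|h e e0].
  have [T [G1 [G2 TE]] CT] := h _ e0; exists G1, G2 => x.
  have -> : G2 (A (lh_inv G1 x)) = T x by rewrite TE.
  apply: le_trans (opnorm_ge x (bB T)) _.
  by rewrite ler_wpM2r ?nrm_ge0 // ltW.
have e20 := divr_gt0 e0 (ltr0n R 2).
have [G1 [G2 GP]] := h _ e20.
have [T TE] := blin_bop
  (blin_comp (blin_comp (lh_blin G2) (bop_blin A)) (lh_inv_blin G1)).
exists T; first by exists G1, G2.
apply: (@le_lt_trans _ _ (e / 2)); last by rewrite ltr_pdivrMr // ltr_pMr // ltr1n.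
by apply: opnorm_le => [|x]; [exact: ltW|rewrite /= TE; exact: GP].
Qed.

(** An operator [B = G2 A G1^-1] close enough to [C] is bounded below on [M],
    and its image of [M] is close to that of [C]. Then [M1] is the inverse
    image of [M] under [G1]. *)
Lemma closure_transfer H K (A C : 'B(H, K)) (M : set H) :
  norm_closure (GG_orbit A) C -> clsub M -> bounded_below C M ->
  exists M1, [/\ clsub M1, bounded_below A M1, hdim M1 #= hdim M,
    hdim (orthc M1) #= hdim (orthc M) &
    hdim (orthc (A @` M1)) #= hdim (orthc (C @` M))].
Proof.
move=> /closure_near near cM [c c0 CM].
have bA := bop_blin A; have bC := bop_blin C.
have c40 : 0 < c / 4 by rewrite divr_gt0.
have [G1 [G2 GP]] := near _ c40.
have b1 := lh_blin G1; have b1' := lh_inv_blin G1.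
have b2 := lh_blin G2; have b2' := lh_inv_blin G2.
pose B x := G2 (A (lh_inv G1 x)).
have bB : blin B by apply: blin_comp (blin_comp b2 bA) b1'.
have BM x : M x -> 3 / 4 * c * nrm x <= nrm (B x).
  move=> Mx; have := CM _ Mx; have := GP x; rewrite -/(B x).
  by have := nrmD (C x - B x) (B x); rewrite subrK; lra.
have c340 : 0 < 3 / 4 * c by lra.
have e1 : hdim (orthc (C @` M)) #= hdim (orthc (B @` M)).
  apply: (close_codim bC bB cM c340) => // x Mx.
    by apply: le_trans (CM _ Mx); rewrite ler_wpM2r ?nrm_ge0 //; lra.
  by apply: le_trans (GP x) _; rewrite ler_wpM2r ?nrm_ge0 //; lra.
have bb1 : bounded_below (lh_inv G1) M.
  by apply: bounded_below_sub (inverse_bounded_below b1 (lh_invK G1)).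
pose M1 := lh_inv G1 @` M.
have cM1 : clsub M1 by exact: bounded_below_image.
have AM1 : bounded_below A M1.
  have [_ [m m0 G2m]] := b2; have [_ [n n0 G1n]] := b1'.
  have m1 : 0 < (m + 1) * (n + 1) by rewrite mulr_gt0 //; lra.
  exists (3 / 4 * c / ((m + 1) * (n + 1))); first by rewrite divr_gt0.
  move=> _ [x Mx <-]; rewrite mulrAC ler_pdivrMr //.
  have h1 : 3 / 4 * c * nrm x <= (m + 1) * nrm (A (lh_inv G1 x)).
    apply: le_trans (BM _ Mx) (le_trans (G2m _) _).
    by rewrite ler_wpM2r ?nrm_ge0 //; lra.
  have h2 : nrm (lh_inv G1 x) <= (n + 1) * nrm x.
    by apply: le_trans (G1n _) _; rewrite ler_wpM2r ?nrm_ge0 //; lra.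
  apply: le_trans (ler_wpM2l (ltW c340) h2) _.
  have n10 : 0 < n + 1 by lra.
  by rewrite mulrCA [leRHS]mulrA [leRHS]mulrC ler_pM2l // [leRHS]mulrC.
exists M1; split=> //.
- by rewrite card_eq_sym; exact: hdim_image.
- by rewrite card_eq_sym; exact: (hdim_orthc_iso b1' b1 (lh_invK G1) (lh_funK G1) cM).
- rewrite card_eq_sym; apply: card_eq_trans e1 _.
  have -> : B @` M = G2 @` (A @` M1) by rewrite !image_comp.
  rewrite card_eq_sym; apply: (hdim_orthc_iso b2 b2' (lh_funK G2) (lh_invK G2)).
  exact: bounded_below_image.
Qed.

(** [G1] and [G2] are assembled from unitary operators so that [C] and
    [G2 A G1^-1] agree on [M]; on the orthogonal complement of [M], where [C]
    is small, [G1^-1] contracts strongly. *)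
Lemma orbit_near H K (A C : 'B(H, K)) (M1 M : set H) (e : R) :
  0 < e -> clsub M1 -> clsub M -> bounded_below A M1 -> bounded_below C M ->
  (forall x, orthc M x -> nrm (C x) <= e * nrm x) ->
  hdim M1 #= hdim M -> hdim (orthc M1) #= hdim (orthc M) ->
  hdim (orthc (A @` M1)) #= hdim (orthc (C @` M)) ->
  exists (G1 : 'G(H)) (G2 : 'G(K)),
    forall x, nrm (C x - G2 (A (lh_inv G1 x))) <= (2 * e) * nrm x.
Proof.
move=> e0 cM1 cM bbA bbC CM' d1 d2 d3.
have bA := bop_blin A; have bC := bop_blin C.
have cA := bounded_below_image bA cM1 bbA.
have cC := bounded_below_image bC cM bbC.
have cM1' := clsub_orthc M1; have cM' := clsub_orthc M.
have [U1 [bU1 U1M U1onto U1ip]] := hdim_unitary cM1 cM d1.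
have [U2 [bU2 U2M U2onto U2ip]] := hdim_unitary cM1' cM' d2.
have [U3 [bU3 U3M U3onto U3ip]] :=
  hdim_unitary (clsub_orthc (A @` M1)) (clsub_orthc (C @` M)) d3.
have isom (L L' : hilbertType R) (U : L -> L') (V : set L) :
    (forall x y, V x -> V y -> inner (U x) (U y) = inner x y) ->
    forall x, V x -> nrm (U x) = nrm x.
  by move=> Uip x Vx; apply: nrm_ip_eq; rewrite Uip.
have U1n := isom _ _ _ _ U1ip; have U2n := isom _ _ _ _ U2ip.
have U3n := isom _ _ _ _ U3ip.
have onto (L L' : hilbertType R) (U : L -> L') (V : set L) (W : set L') :
    (forall x, V x -> W (U x)) -> (forall w, W w -> exists2 x, V x & U x = w) ->
    U @` V = W.
  by move=> UV UW; apply/seteqP; split=> [_ [x /UV Wx <-] //|w /UW[x Vx <-]]; exists x.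
have [S [bS SM AS SA]] := bounded_below_inverse bA cM1 bbA.
have [||||G2 [G2A G2A']] := @homeo_glue _ _ (A @` M1) (C @` M)
    (C \o U1 \o S) U3 cA cC (blin_comp (blin_comp bC bU1) bS) bU3.
- have [c c0 Cc] := bbC; have [_ [m m0 Am]] := bA; have m1 : 0 < m + 1 by lra.
  exists (c / (m + 1)); first by rewrite divr_gt0.
  move=> _ [x Mx <-] /=; rewrite SA //; apply: le_trans (Cc _ (U1M _ Mx)).
  rewrite U1n // mulrAC ler_pdivrMr // -mulrA ler_pM2l // mulrC.
  by apply: le_trans (Am x) _; rewrite ler_wpM2r ?nrm_ge0 //; lra.
- apply: onto => [_ [x Mx <-]|_ [x Mx <-]] /=.
    by exists (U1 x); [exact: U1M|rewrite SA].
  have [y My <-] := U1onto _ Mx.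
  by exists (A y); [exists y|rewrite SA].
- by exists 1 => // x Mx; rewrite mul1r U3n.
- exact: onto.
have [_ [m m0 Am]] := bA; have [_ [n n0 G2n]] := lh_blin G2.
pose t := e / ((m + 1) * (n + 1)).
have mn0 : 0 < (m + 1) * (n + 1) by rewrite mulr_gt0 //; lra.
have t0 : 0 < t by rewrite divr_gt0.
have tinv0 : 0 <= t^-1 by rewrite invr_ge0 ltW.
have [||||G1 [G1M G1M']] := @homeo_glue _ _ M1 M U1 (fun x => (t^-1)%:C *: U2 x)
    cM1 cM bU1 (blin_scale _ bU2).
- by exists 1 => // x Mx; rewrite mul1r U1n.
- exact: onto.
- by exists t^-1; [rewrite invr_gt0|move=> x Mx; rewrite nrmZr // U2n].
- apply: onto => [x Mx|w Mw]; first by apply: clsubZ => //; exact: U2M.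
  have [x Mx xw] := U2onto _ (clsubZ t%:C cM' Mw); exists x => //.
  by rewrite xw scalerA -rmorphM mulVf ?gt_eqF // scale1r.
exists G1, G2 => x.
pose B y := G2 (A (lh_inv G1 y)).
have bB : blin B.
  exact: blin_comp (blin_comp (lh_blin G2) bA) (lh_inv_blin G1).
have BM y : M y -> B y = C y.
  move=> /U1onto[z Mz <-]; rewrite /B -G1M // lh_funK G2A /=; last by exists z.
  by rewrite SA // G1M.
have BM' y : orthc M y -> nrm (B y) <= e * nrm y.
  move=> My; have [z Mz zy] := U2onto _ (clsubZ t%:C cM' My).
  have nz : nrm z = t * nrm y by rewrite -U2n // zy nrmZr // ltW.
  have <- : G1 z = y.
    by rewrite G1M' // zy scalerA -rmorphM mulVf ?gt_eqF // scale1r.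
  rewrite /B lh_funK G1M' // nrmZr // U2n // nz mulKf ?gt_eqF //.
  have h1 : nrm (A z) <= (m + 1) * (t * nrm y).
    by rewrite -nz; apply: le_trans (Am z) _; rewrite ler_wpM2r ?nrm_ge0 //; lra.
  apply: le_trans (G2n _) _.
  apply: (@le_trans _ _ ((n + 1) * ((m + 1) * (t * nrm y)))).
    by apply: ler_pM; rewrite ?nrm_ge0 //; lra.
  have te : (n + 1) * ((m + 1) * t) = e.
    have m10 : 0 < m + 1 by lra.
    have n10 : 0 < n + 1 by lra.
    by rewrite /t; field; rewrite !gt_eqF.
  by rewrite -te !mulrA.
rewrite -/(B x); set p := proj M x; set q := x - p.
have xpq : x = p + q by rewrite addrC subrK.
have Mp : M p by exact: proj_in.
have Mq : orthc M q by exact: proj_orth.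
have -> : C x - B x = C q - B q.
  by rewrite [in LHS]xpq (blinD p q bC) (blinD p q bB) BM // opprD addrACA subrr add0r.
have qx : nrm q <= nrm x by exact: projC_nrm.
apply: le_trans (nrmB _ _) _; have := CM' _ Mq; have := BM' _ Mq.
have : e * nrm q <= e * nrm x by rewrite ler_wpM2l // ltW.
by lra.
Qed.

End Orbits.

Section Indices.
Context {R : realType} {H K : hilbertType R}.
Implicit Types A C : 'B(H, K).

Lemma hdimT_split (L : hilbertType R) (M : set L) : clsub M ->
  hdim [set: L] #= hdim M #+ hdim (orthc M).
Proof. by move=> cM; apply: hdim_ominus => //; exact: clsubT. Qed.

Lemma iota_codim A (M : set H) : clsub M -> bounded_below A M ->
  IC (range A) #= hdim (ominus (closure (range A)) (A @` M)) ->
  iota_i A #= hdim (orthc M) /\ iota_f A #= hdim (orthc (A @` M)).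
Proof.
move=> cM bM h; have bA := bop_blin A; split; rewrite card_eq_sym.
  apply: card_eq_trans (codim_source bA cM bM) _.
  by apply: card_add_eqr; rewrite card_eq_sym.
apply: card_eq_trans (codim_target bA cM bM) _.
by apply: card_add_eqr; rewrite card_eq_sym.
Qed.

Lemma iota_excess A (M : set H) : clsub M -> bounded_below A M ->
  exists a : set K, hdim (orthc M) #= iota_i A #+ a /\
    hdim (orthc (A @` M)) #= iota_f A #+ a.
Proof.
move=> cM bM; have bA := bop_blin A.
have [_ Amin] := IC_optimal bA.
have [|a ha] := card_le_diff (Amin (A @` M) (bounded_below_image bA cM bM) _).
  by move=> _ [x _ <-]; exists x.
exists a; split.
  apply: card_eq_trans (codim_source bA cM bM) _.
  by apply: card_eq_trans (card_add_eqr _ ha) (card_addA _ _ _).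
apply: card_eq_trans (codim_target bA cM bM) _.
by apply: card_eq_trans (card_add_eqr _ ha) (card_addA _ _ _).
Qed.

Lemma iota_optimal A : exists M, [/\ clsub M, bounded_below A M,
  IC (range A) #= hdim (ominus (closure (range A)) (A @` M)),
  iota_i A #= hdim (orthc M) & iota_f A #= hdim (orthc (A @` M))].
Proof.
have bA := bop_blin A; have [[V [cV VA VE]] _] := IC_optimal bA.
have [M [cM bM MV]] := closed_subrange bA cV VA.
have hM : IC (range A) #= hdim (ominus (closure (range A)) (A @` M)).
  by rewrite VE MV card_eqxx.
by have [hi hf] := iota_codim cM bM hM; exists M.
Qed.

Lemma iota_r_split A (M : set H) : clsub M -> bounded_below A M ->
  iota_r A #= hdim M #+ hdim (ominus (closure (range A)) (A @` M)).
Proof.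
move=> cM bM; have bA := bop_blin A.
have e : hdim (A @` M) #= hdim M by rewrite card_eq_sym; exact: hdim_image.
apply: card_eq_trans (card_add_eql _ e).
apply: hdim_ominus; [exact: clsub_closure_range|exact: bounded_below_image|].
by move=> _ [x _ <-]; exact: range_closure.
Qed.

Lemma hdim_le_iota_r A (M : set H) : clsub M -> bounded_below A M ->
  hdim M #<= iota_r A.
Proof.
move=> cM bM; apply: card_le_trans (card_eqWr (iota_r_split cM bM)).
exact: card_le_addr.
Qed.

Lemma iota_b1P A : iota_b A = 1%N <->
  exists M, [/\ clsub M, bounded_below A M & iota_r A #<= hdim M].
Proof.
have bA := bop_blin A; rewrite /iota_b binary_index1P //; split.
  move=> [V [cV VA VE]]; have [M [cM bM MV]] := closed_subrange bA cV VA.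
  exists M; split=> //; apply: card_le_trans (card_eqWr VE) _.
  by apply: card_eqWr; rewrite -MV; exact: hdim_image.
move=> [M [cM bM h]]; exists (A @` M); split.
- exact: bounded_below_image.
- by move=> _ [x _ <-]; exists x.
- have e := hdim_image bA cM bM; rewrite card_eq_sym.
  apply: card_eq_trans e; apply: card_le_sym => //.
  exact: hdim_le_iota_r.
Qed.

Lemma iota_b_cases A : iota_b A = 0%N \/ iota_b A = 1%N.
Proof. by rewrite /iota_b /binary_index; case: asboolP; [right|left]. Qed.

(** On the complements of the spectral subspaces [A] is arbitrarily small, so
    that their images approximate the whole range. *)
Lemma iota_r_approx A (T : Type) (Y : set T) :
  (forall M, clsub M -> bounded_below A M -> hdim M #<= Y) -> iota_r A #<= Y.
Proof.
move=> h; have bA := bop_blin A; apply: hdim_range_approx => // e e0.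
have [M [cM Me Me']] := spectral_split bA e0.
have bM : bounded_below A M by exists e.
exists (A @` M); split; first exact: bounded_below_image.
  apply: card_le_trans (card_eqWr (hdim_image bA cM bM)) _; exact: h.
move=> x; exists (A (proj M x)); first by exists (proj M x) => //; exact: proj_in.
rewrite -(blinB _ _ bA); apply: le_trans (Me' _ (proj_orth x cM)) _.
by rewrite ler_wpM2l ?projC_nrm // ltW.
Qed.

(** If [iota_r A] were finite, the dimensions of the spectral subspaces, which
    are not all smaller than [iota_r A], would reach it, and [iota_b A] would
    be 1. *)
Lemma iota_b0_infinite A : iota_b A = 0%N -> infinite_set (iota_r A).
Proof.
move=> b0 [n rn].
suff : iota_b A = 1%N by rewrite b0.
apply/iota_b1P; apply: contrapT => h.
case: n rn => [|n] rn.
  have bA := bop_blin A; have [M [cM Me _]] := spectral_split bA (@ltr01 R).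
  apply: h; exists M; split=> //; first by exists 1.
  by rewrite (card_le_eql rn) II0; exact: card_ge0.
have : iota_r A #<= `I_n.
  apply: iota_r_approx => M cM bM; apply: contrapT => /card_ge_II nM.
  by apply: h; exists M; split=> //; rewrite (card_le_eql rn).
by rewrite (card_le_eql rn) card_le_II ltnn.
Qed.

Lemma iota_r_closure A C : norm_closure (GG_orbit A) C -> iota_r C #<= iota_r A.
Proof.
move=> /closure_near near; have bA := bop_blin A.
apply: hdim_range_approx; first exact: bop_blin.
move=> e /near[G1 [G2 GP]]; pose B x := G2 (A (lh_inv G1 x)).
have bB : blin B.
  exact: blin_comp (blin_comp (lh_blin G2) bA) (lh_inv_blin G1).
exists (closure (range B)); split; first exact: clsub_closure_range.
  apply: (hdim_ge_pairing (lh_blin G2)); try exact: clsub_closure_range.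
  move=> w Bw h; apply: (orthc_self Bw); apply: orthc_closure_range => x.
  by apply/ip_eq0C/h; exact: range_closure.
by move=> x; exists (B x); [exact: range_closure|exact: GP].
Qed.

(** If [iota_r A] is infinite and a complete subspace of minimal codimension
    has smaller dimension, then the minimal codimension is [iota_r A], which no
    codimension exceeds: the given subspace of full dimension is optimal too.
    If [iota_r A] is finite, a subspace of full dimension has codimension 0. *)
Lemma iota_optimal_full A : iota_b A = 1%N ->
  exists M, [/\ clsub M, bounded_below A M, iota_r A #<= hdim M,
    iota_i A #= hdim (orthc M) & iota_f A #= hdim (orthc (A @` M))].
Proof.
move=> /iota_b1P[M [cM bM rM]]; have bA := bop_blin A.
have [_ Amin] := IC_optimal bA.
have ICM : IC (range A) #<= hdim (ominus (closure (range A)) (A @` M)).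
  by apply: Amin; [exact: bounded_below_image|move=> _ [x _ <-]; exists x].
have [M0 [cM0 bM0 IC0 hi hf]] := iota_optimal A.
have [h|h] := pselect (iota_r A #<= hdim M0); first by exists M0.
have rs := iota_r_split cM bM; have rs0 := iota_r_split cM0 bM0.
have cod_le : hdim (ominus (closure (range A)) (A @` M)) #<= IC (range A).
  have [fr|ir] := pselect (finite_set (iota_r A)).
    have fM : finite_set (hdim M) by exact: card_le_finite (hdim_le_iota_r cM bM) fr.
    apply: card_le_trans (card_ge0 _ _ : @set0 void #<= _).
    apply: (card_add_cancel_le fM (card_eqxx _)).
    apply: card_le_trans (card_eqWr rs) (card_le_trans rM _).
    exact: card_le_addr.
  have [//|r0] := card_add_lt ir (card_eqW rs0).
  apply: card_le_trans (card_eqWr IC0); apply: card_le_trans r0.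
  by apply: card_le_trans (card_eqWr rs); exact: card_le_addl.
have [hi' hf'] := iota_codim cM bM (card_le_sym ICM cod_le).
by exists M.
Qed.

(** If [iota_b A = 1], the subspace [M1] is cut out of an optimal subspace of
    full dimension, and [card_exchange] finds the dimension of what has to be
    left out. If [iota_b A = 0], then [iota_r A] is infinite and larger than
    [dim M], some spectral subspace of [A] has dimension at least [dim M], and
    any [M1] of dimension [dim M] in it has codimensions that absorb both
    [dim M] and [a]. *)
Lemma matching_subspace A C (M : set H) (T : Type) (a : set T) :
  clsub M -> bounded_below C M ->
  hdim M #<= iota_r A -> (iota_b A = 0%N -> ~ (iota_r A #<= hdim M)) ->
  hdim (orthc M) #= iota_i A #+ a ->
  hdim (orthc (C @` M)) #= iota_f A #+ a ->
  exists M1, [/\ clsub M1, bounded_below A M1, hdim M1 #= hdim M,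
    hdim (orthc M1) #= hdim (orthc M) &
    hdim (orthc (A @` M1)) #= hdim (orthc (C @` M))].
Proof.
move=> cM bM Mr Mr0 hi hf; have bA := bop_blin A; have bC := bop_blin C.
have cCM := bounded_below_image bC cM bM.
have hCM := hdim_image bC cM bM.
case: (iota_b_cases A) => [b0|/iota_optimal_full[M0 [cM0 bM0 rM0 i0 f0]]].
  have nr := Mr0 b0; have ir := iota_b0_infinite b0.
  have [M2 [cM2 bM2 M2M]] : exists M2, [/\ clsub M2, bounded_below A M2 & hdim M #<= hdim M2].
    apply: contrapT => h; apply: nr; apply: iota_r_approx => M2 cM2 bM2.
    have [//|h'] := card_le_total (hdim M2) (hdim M).
    by exfalso; apply: h; exists M2.
  have [m hm] := card_le_diff M2M.
  have [M1 [cM1 M12 M1M _]] := hdim_split cM2 hm.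
  have bM1 := bounded_below_sub M12 bM2.
  set ic := hdim (ominus (closure (range A)) (A @` M1)).
  have ric : iota_r A #<= ic.
    have [h|//] := card_add_lt ir (card_eqW (iota_r_split cM1 bM1)).
    by exfalso; apply: nr; apply: card_le_trans h (card_eqW M1M).
  have icr : ic #<= iota_r A.
    by apply: card_le_trans (card_eqWr (iota_r_split cM1 bM1)); exact: card_le_addl.
  have rIC : iota_r A #<= IC (range A).
    have [M0 [cM0 bM0 IC0 _ _]] := iota_optimal A.
    have [h|h] := card_add_lt ir (card_eqW (iota_r_split cM0 bM0)).
      have : iota_b A = 1%N by apply/iota_b1P; exists M0.
      by rewrite b0.
    exact: card_le_trans h (card_eqWr IC0).
  (* The dimension of [L] is that of [orthc V], which absorbs [dim V]; it bounds
     the dimension of [orthc W]. *)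
  have absorb (L : hilbertType R) (V W : set L) (T' : Type) (n : set T') :
      clsub V -> clsub W -> hdim V #= hdim M -> hdim (orthc V) #= n #+ ic ->
      hdim (orthc W) #= n #+ IC (range A) #+ a ->
      hdim (orthc V) #= hdim (orthc W).
    move=> cV cW VM hV hW; apply: card_le_sym.
      apply: card_le_trans (card_eqW hV) _.
      apply: card_le_trans (card_eqWr hW).
      apply: card_le_trans (card_le_addr _ a).
      apply: card_add_le2; first exact: card_lexx.
      exact: card_le_trans icr rIC.
    have rV : iota_r A #<= hdim (orthc V).
      apply: card_le_trans (card_eqWr hV); apply: card_le_trans ric _.
      exact: card_le_addl.
    apply: card_le_trans (hdim_sub (clsub_orthc W) (clsubT (H := L)) (@subsetT _ _)) _.
    apply: card_le_trans (card_eqW (hdimT_split cV)) _.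
    apply/card_eqW/card_add_absorb; first by move=> /(card_le_finite rV).
    apply: card_le_trans (card_eqW VM) _.
    exact: card_le_trans Mr rV.
  exists M1; split=> //.
    exact: (absorb H M1 M _ _ cM1 cM M1M (codim_source bA cM1 bM1) hi).
  have AM1M : hdim (A @` M1) #= hdim M.
    by apply: card_eq_trans M1M; rewrite card_eq_sym; exact: hdim_image.
  exact: (absorb K _ _ _ _ (bounded_below_image bA cM1 bM1) cCM AM1M
    (codim_target bA cM1 bM1) hf).
have hAM0 := hdim_image bA cM0 bM0; have cAM0 := bounded_below_image bA cM0 bM0.
have total (L : hilbertType R) (V W : set L) (T' : Type) (n : set T') :
    clsub V -> clsub W -> hdim V #= hdim M0 -> hdim W #= hdim M ->
    n #= hdim (orthc V) -> hdim (orthc W) #= n #+ a ->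
    n #+ hdim M0 #= hdim M #+ (n #+ a).
  move=> cV cW VM0 WM nV hW.
  apply: card_eq_trans (card_addC _ _) _.
  apply: card_eq_trans (card_add_eq2 _ nV) _; first by rewrite card_eq_sym; exact: VM0.
  rewrite card_eq_sym; apply: card_eq_trans (hdimT_split cV).
  rewrite card_eq_sym; apply: card_eq_trans (hdimT_split cW) _.
  exact: card_add_eq2.
have [|||T' [m [vm im fm]]] := @card_exchange _ _ _ _ _ (iota_i A) (iota_f A)
    (hdim M0) (hdim M) a.
- exact: card_le_trans rM0.
- by apply: (total H M0 M) => //; exact: card_eqxx.
- apply: (total K (A @` M0) (C @` M)) => //.
    by rewrite card_eq_sym.
  by rewrite card_eq_sym.
have [M1 [cM1 M10 M1M M1m]] := hdim_split cM0 vm.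
have bM1 := bounded_below_sub M10 bM0.
exists M1; split=> //.
  apply: card_eq_trans (hdim_orthc_orthc cM0 cM1 M10) _.
  apply: card_eq_trans (card_addC _ _) _.
  apply: card_eq_trans (card_add_eq2 _ M1m) _; first by rewrite card_eq_sym; exact: i0.
  by apply: card_eq_trans im _; rewrite card_eq_sym.
have A10 : A @` M1 `<=` A @` M0 by move=> _ [x /M10 Mx <-]; exists x.
apply: card_eq_trans (hdim_orthc_orthc cAM0 (bounded_below_image bA cM1 bM1) A10) _.
apply: card_eq_trans (card_addC _ _) _.
apply: card_eq_trans (card_add_eq2 (A' := iota_f A) (B' := m) _ _) _.
- by rewrite card_eq_sym.
- apply: card_eq_trans M1m; rewrite card_eq_sym.
  exact: hdim_image_ominus.
- by apply: card_eq_trans fm _; rewrite card_eq_sym.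
Qed.

End Indices.

Theorem theorem3p9 (R : realType) (H K : hilbertType R) :
  (forall A : 'B(H, K),
     norm_closure (GG_orbit A) =
     [set C | [/\ iota_r C #<= iota_r A,
                  iota_b A = 0%N -> iota_b C = 1%N -> iota_r C #< iota_r A &
                  exists (T : Type) (alpha : set T),
                    iota_i C #= iota_i A #+ alpha /\
                    iota_f C #= iota_f A #+ alpha]]) /\
  (forall C : 'B(H, K),
     iota_i C #= 'dim H -> iota_f C #= 'dim K ->
     forall A : 'B(H, K),
       exists (T : Type) (alpha : set T),
         iota_i C #= iota_i A #+ alpha /\
         iota_f C #= iota_f A #+ alpha).
Proof.
split=> [A|C Ci Cf A]; last first.
  have bA := bop_blin A; have [M [cM bM _ hi hf]] := iota_optimal A.
  exists H, (hdim M); split.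
    apply: card_eq_trans Ci _; apply: card_eq_trans (hdimT_split cM) _.
    apply: card_eq_trans (card_addC _ _) _.
    by apply: card_add_eql; rewrite card_eq_sym.
  apply: card_eq_trans Cf _.
  apply: card_eq_trans (hdimT_split (bounded_below_image bA cM bM)) _.
  apply: card_eq_trans (card_addC _ _) _.
  by apply: card_add_eq2; rewrite card_eq_sym //; exact: hdim_image.
apply/seteqP; split=> C.
  move=> AC; have rCA := iota_r_closure AC; split=> //.
    move=> b0 /iota_b1P[M [cM bM rM]]; split=> // rAC.
    have [M1 [cM1 bM1 M1M _ _]] := closure_transfer AC cM bM.
    suff : iota_b A = 1%N by rewrite b0.
    apply/iota_b1P; exists M1; split=> //.
    by apply: card_le_trans rAC (card_le_trans rM (card_eqWr M1M)).
  have [M [cM bM _ hi hf]] := iota_optimal C.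
  have [M1 [cM1 bM1 _ hi1 hf1]] := closure_transfer AC cM bM.
  have [a [ai af]] := iota_excess cM1 bM1; exists K, a; split.
    apply: card_eq_trans hi _; apply: card_eq_trans ai.
    by rewrite card_eq_sym.
  apply: card_eq_trans hf _; apply: card_eq_trans af.
  by rewrite card_eq_sym.
move=> [rCA bCA [T [alpha [ai af]]]].
have bC := bop_blin C; apply/closure_near => e e0.
have e20 := divr_gt0 e0 (ltr0n R 2).
have [M [cM Me Me']] := spectral_split bC e20.
have bM : bounded_below C M by exists (e / 2).
have MC := hdim_le_iota_r cM bM.
have [d [di df]] := iota_excess cM bM.
have [||||M1 [cM1 bM1 d1 d2 d3]] :=
    @matching_subspace R H K A C M _ (alpha #+ d) cM bM.
- exact: card_le_trans MC rCA.
- move=> b0 rM; have b1 : iota_b C = 1%N.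
    by apply/iota_b1P; exists M; split=> //; exact: card_le_trans rCA rM.
  by have [_] := bCA b0 b1; apply; exact: card_le_trans rM MC.
- apply: card_eq_trans di _; apply: card_eq_trans (card_add_eql _ ai) _.
  by rewrite card_eq_sym; exact: card_addA.
- apply: card_eq_trans df _; apply: card_eq_trans (card_add_eql _ af) _.
  by rewrite card_eq_sym; exact: card_addA.
have [G1 [G2 GP]] := orbit_near e20 cM1 cM bM1 bM Me' d1 d2 d3.
exists G1, G2 => x; apply: le_trans (GP x) _.
by rewrite mulrCA mulfV ?mulr1 // pnatr_eq0.
Qed.
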